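(* Assume $(\mathcal H_1)$–$(\mathcal H_6)$ (listed in the context). Let $\mathcal D$ be a discretization of $\Omega$ and let $\delta t=T/N$ with $N\in\mathbb N\setminus\{0\}$ and $\delta t<\underline\beta/\underline F$. Then the discrete problem (defined in the context) has at least one solution $(u^n)_{1\le n\le N}$, $u^n\in X_{\mathcal D,0}$.
   Context: **Data.** $\Omega$ is a bounded open connected polyhedral subset of $\mathbb{R}^d$, $d\in\mathbb{N}\setminus\{0\}$, $T>0$, $Q_T=\Omega\times(0,T)$. Hypotheses: $(\mathcal H_1)$ $\beta\in C(\mathbb R)$, $\beta(0)=0$, $\beta$ is strictly increasing, and there is $\underline\beta>0$ with $|\beta(a)-\beta(b)|\ge\underline\beta|a-b|$ for all $a,b\in\mathbb R$; there exist $P>0$ and $C_\beta$ such that $|\beta(u)|\le C_\beta$ for $|u|\le P$, and $\beta$ is Lipschitz continuous with constant $\overline\beta$ for $|u|\ge P$. $(\mathcal H_2)$ $\mathbf\Lambda$ is a measurable function from $\Omega$ to the symmetric $d\times d$ real matrices such that for a.e. $\mathbf x$ the eigenvalues of $\mathbf\Lambda(\mathbf x)$ lie in $[\lambda_m(\mathbf x),\lambda_M(\mathbf x)]$, with $\lambda_m,\lambda_M\in L^\infty(\Omega)$ and constants $0<\underline\lambda\le\lambda_m(\mathbf x)\le\lambda_M(\mathbf x)\le\overline\lambda$. $(\mathcal H_3)$ $\mathbf V\in H(\mathrm{div},\Omega)\cap L^\infty(\Omega)$ with $\nabla\cdot\mathbf V\ge0$ a.e. in $\Omega$. $(\mathcal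 H_4)$ $u_0\in L^\infty(\Omega)$. $(\mathcal H_5)$ $F\in C(\mathbb R)$, $F(0)=0$, there is $M>0$ such that $uF(u)>0$ and $F$ is Lipschitz continuous with constant $L_F$ for all $u<0$ or $u>M$; there is $\underline F>0$ with $(F(u)-F(v))(u-v)\ge-\underline F(u-v)^2$ for all $u,v\in\mathbb R$. $(\mathcal H_6)$ $q\in L^2(Q_T)$. **Discretization.** A discretization of $\Omega$ is a triplet $\mathcal D=(\mathcal M,\mathcal E,\mathcal P)$ where: (1) $\mathcal M$ is a finite family of nonempty connected open disjoint subsets $K$ of $\Omega$ (control volumes) with $\overline\Omega=\bigcup_{K\in\mathcal M}\overline K$; $m(K)>0$ is the measure of $K$. (2) $\mathcal E$ is a finite family of disjoint subsets of $\overline\Omega$ (edges/faces); each $\sigma\in\mathcal E$ is a nonempty open subset of a hyperplane of $\mathbb R^d$ with $(d-1)$-dimensional measure $m(\sigma)>0$; for each $K$ there is $\mathcal E_K\subset\mathcal E$ with $\partial K=\bigcup_{\sigma\in\mathcal E_K}\overline\sigma$; with $\mathcal M_\sigma=\{K\in\mathcal M:\sigma\in\mathcal E_K\}$, either $\mathcal M_\sigma$ has exactly one element and $\sigma\subset\partial\Omega$ ($\sigma\in\mathcal E_{ext}$), or $\mathcal M_\sigma$ has exactly two elements ($\sigma\in\mathcal E_{int}$). $\mathbf x_\sigma$ is the barycenter of $\sigma$, $\mathbf n_{K,\sigma}$ the unit normal to $\sigma$ outward to $K$. (3) $\mathcal P=(\mathbf x_K)_{K\in\mathcal M}$ with $\mathbf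 x_K\in K$ and $K$ star-shaped with respect to $\mathbf x_K$; the distance $d_{K,\sigma}$ from $\mathbf x_K$ to the hyperplane containing $\sigma\in\mathcal E_K$ is assumed positive; $D_{K,\sigma}$ is the cone with vertex $\mathbf x_K$ and basis $\sigma$. $X_{\mathcal D}=\{((v_K)_{K\in\mathcal M},(v_\sigma)_{\sigma\in\mathcal E}):v_K,v_\sigma\in\mathbb R\}$, $X_{\mathcal D,0}=\{v\in X_{\mathcal D}:v_\sigma=0\ \forall\sigma\in\mathcal E_{ext}\}$. **Discrete gradient.** For $u\in X_{\mathcal D}$: $\nabla_Ku=\frac1{m(K)}\sum_{\sigma\in\mathcal E_K}m(\sigma)(u_\sigma-u_K)\mathbf n_{K,\sigma}$, $R_{K,\sigma}u=\frac{\sqrt d}{d_{K,\sigma}}\big(u_\sigma-u_K-\nabla_Ku\cdot(\mathbf x_\sigma-\mathbf x_K)\big)$, and $\nabla_{\mathcal D}u$ is the piecewise constant function equal to $\nabla_Ku+(R_{K,\sigma}u)\mathbf n_{K,\sigma}$ on $D_{K,\sigma}$. **Discrete problem.** $\langle v,u\rangle_F=\int_\Omega\nabla_{\mathcal D}v\cdot\mathbf\Lambda\nabla_{\mathcal D}u\,d\mathbf x$. With $V_{K,\sigma}=\int_\sigma\mathbf V\cdot\mathbf n_{K,\sigma}d\gamma$ and $\overline{u_{K,\sigma}}=u_K$ if $V_{K,\sigma}\ge0$, $\overline{u_{K,\sigma}}=u_\sigma$ if $V_{K,\sigma}<0$, set $\langle v,u\rangle_T=\sum_{K}\sum_{\sigma\in\mathcal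 E_K}(v_K-v_\sigma)V_{K,\sigma}\overline{u_{K,\sigma}}$. Let $t_n=n\,\delta t$, $q_K^n=\frac1{\delta t\,m(K)}\int_{t_{n-1}}^{t_n}\int_Kq\,d\mathbf x\,dt$, $u_K^0=\frac1{m(K)}\int_Ku_0\,d\mathbf x$. The discrete problem: for each $n\in\{1,\dots,N\}$ find $u^n\in X_{\mathcal D,0}$ such that for all $v\in X_{\mathcal D,0}$ $$\sum_Km(K)v_K\frac{\beta(u_K^n)-\beta(u_K^{n-1})}{\delta t}+\langle v,u^n\rangle_F+\langle v,u^n\rangle_T+\sum_Km(K)v_KF(u_K^n)=\sum_Km(K)v_Kq_K^n.$$ *)

(* Defs.v *)
From HB Require Import structures.
From mathcomp Require Import all_boot all_order all_algebra.
From mathcomp Require Import all_classical all_reals all_analysis.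

Set Implicit Arguments.
Unset Strict Implicit.
Unset Printing Implicit Defensive.

Import Order.TTheory GRing.Theory Num.Theory.
Import numFieldNormedType.Exports.

Local Open Scope classical_set_scope.
Local Open Scope ring_scope.
(* The sigma-algebra on R^n generated by the coordinates, i.e. the Borel one. *)
Definition rV_display : measure_display. Proof. exact. Qed.
Section rV_measurable.
Context (R : realType) (n : nat).
Let coords (i : 'I_n) (x : 'rV[R]_n) : measurableTypeR R := x ord0 i.
Let rV_set0 : g_sigma_preimage coords set0.
Proof. exact: sigma_algebra0. Qed.
Let rV_setC A : g_sigma_preimage coords A -> g_sigma_preimage coords (~` A).
Proof. exact: sigma_algebraC. Qed.
Let rV_bigcup (F : _^nat) : (forall i, g_sigma_preimage coords (F i)) ->
  g_sigma_preimage coords (\bigcup_i F i).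
Proof. exact: sigma_algebra_bigcup. Qed.
HB.instance Definition _ := @isMeasurable.Build rV_display 'rV[R]_n
  (g_sigma_preimage coords) rV_set0 rV_setC rV_bigcup.
End rV_measurable.

Lemma measurable_rV_coord (R : realType) n (i : 'I_n) :
  measurable_fun [set: 'rV[R]_n] (fun x => x ord0 i : measurableTypeR R).
Proof.
move=> _ Y mY; rewrite setTI; apply: sub_sigma_algebra => /=.
rewrite -bigcup_seq/=; exists i => /=; first by rewrite mem_index_enum.
by exists Y => //; rewrite setTI.
Qed.

Definition rV_cons (R : realType) n (p : measurableTypeR R * 'rV[R]_n) :
    'rV[R]_n.+1 :=
  row_mx (p.1 : R)%:M p.2 : 'rV_(1 + n).

Lemma measurable_rV_cons (R : realType) n :
  measurable_fun [set: measurableTypeR R * 'rV[R]_n] (@rV_cons R n).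
Proof.
apply: measurability => //= _ [A + <-].
rewrite -bigcup_seq => -[i _ [Y mY <-]]; rewrite setTI.
suff mi : measurable_fun [set: measurableTypeR R * 'rV[R]_n]
    (fun p => rV_cons p ord0 i : measurableTypeR R).
  by have := mi measurableT Y mY; rewrite !setTI.
case: (unliftP ord0 i) => [j ->|->].
- rewrite (_ : (fun p => _) = (fun x : 'rV[R]_n => x ord0 j : measurableTypeR R) \o snd).
    by apply: measurableT_comp; [exact: measurable_rV_coord|exact: measurable_snd].
  apply/funext => -[a x] /=; rewrite /rV_cons.
  rewrite (_ : lift ord0 j = rshift 1 j) ?(@row_mxEr _ _ 1 n)//.
  by apply/val_inj.
- rewrite (_ : (fun p => _) = fst); first exact: measurable_fst.
  apply/funext => -[a x] /=; rewrite /rV_cons.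
  transitivity (((a : R)%:M : 'M[R]_1) ord0 ord0); last by rewrite mxE mulr1n.
  rewrite -(row_mxEl (a : R)%:M x); congr (row_mx _ _ _ _); exact/val_inj.
Qed.


Section lebesgue_rV_succ.
Context (R : realType) (n : nat) (mu : {measure set 'rV[R]_n -> \bar R}).

Definition lebesgue_rV_succ : set 'rV[R]_n.+1 -> \bar R :=
  pushforward (@lebesgue_measure R \x^ mu)%E (@rV_cons R n).

HB.instance Definition _ := Measure.copy lebesgue_rV_succ
  (@measure_function_pushforward__canonical__measure_function_Measure
    _ _ _ _ _ (@lebesgue_measure R \x^ mu)%E (@rV_cons R n) (@measurable_rV_cons R n)).
End lebesgue_rV_succ.

(* n-dimensional Lebesgue measure, as an iterated product; R^0 is a point of
   measure 1, so that faces have measure 1 in space dimension 1. *)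
Fixpoint lebesgue_rV (R : realType) n : {measure set 'rV[R]_n -> \bar R} :=
  if n is m.+1 then lebesgue_rV_succ (lebesgue_rV R m)
  else dirac (0 : 'rV[R]_0).

Lemma lebesgue_rV_box (R : realType) n (I : 'I_n -> set (measurableTypeR R)) :
  (forall i, measurable (I i)) ->
  lebesgue_rV R n [set x | forall i, I i (x ord0 i)] =
  (\prod_(i < n) lebesgue_measure (I i))%E.
Proof.
elim: n I => [|n IHn] I mI.
  rewrite big_ord0 /= diracE mem_set //=.
  by case.
rewrite big_ord_recl /= /lebesgue_rV_succ /pushforward.
rewrite -(IHn (fun i => I (lift ord0 i))) //.
pose box := [set x : 'rV[R]_n | forall i, I (lift ord0 i) (x ord0 i)].
have mbox : measurable box.
  rewrite (_ : box = \big[setI/setT]_(i < n)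
      ((fun x : 'rV[R]_n => x ord0 i : measurableTypeR R) @^-1` I (lift ord0 i))).
    apply: bigsetI_measurable => i _.
    by rewrite -[X in measurable X]setTI; exact: measurable_rV_coord.
  rewrite -bigcap_seq; apply/seteqP; split => [x bx i _|x bx i]; first exact: bx.
  by apply: (bx i); rewrite /= mem_index_enum.
rewrite -product_measure2E //; congr (product_measure2 _ _ _).
have cons0 a (x : 'rV[R]_n) : rV_cons (a, x) ord0 ord0 = a.
  transitivity (((a : R)%:M : 'M[R]_1) ord0 ord0); last by rewrite mxE mulr1n.
  rewrite -(row_mxEl (a : R)%:M x); congr (row_mx _ _ _ _); exact/val_inj.
have consS a (x : 'rV[R]_n) i : rV_cons (a, x) ord0 (lift ord0 i) = x ord0 i.
  by rewrite (_ : lift ord0 i = rshift 1 i) ?(@row_mxEr _ _ 1 n)//; apply/val_inj.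
apply/seteqP; split => [[a x] /= ax|[a x] /= [Ia bx] i].
  by split=> [|i]; [have := ax ord0; rewrite cons0|have := ax (lift ord0 i); rewrite consS].
by case: (unliftP ord0 i) => [j ->|->]; rewrite ?consS ?cons0.
Qed.

Definition vol (R : realType) n (A : set 'rV[R]_n) : R := fine (lebesgue_rV R n A).

(* L^p(D): functions defined everywhere, but only their values on D matter. *)
Definition Lp_on d (T : measurableType d) (R : realType)
    (mu : {measure set T -> \bar R}) (p : \bar R) (D : set T) (f : T -> R) :=
  (f \_ D : T -> R) \in Lfun mu p.

Section euclidean.
Context (R : realType) (d : nat).
Implicit Types (x y : 'rV[R]_d) (A : set 'rV[R]_d).

(* The library norm `|x| on 'rV[R]_d is the sup norm. *)
Definition dotv x y : R := (x *m y^T) ord0 ord0.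

Definition enorm x : R := Num.sqrt (dotv x x).

Definition edist x A : R := inf [set enorm (x - y) | y in A].

Definition frontier A : set 'rV[R]_d := closure A `\` interior A.

Definition star_shaped x A :=
  forall y, A y -> forall t, 0 <= t <= 1 -> A (x + t *: (y - x)).

Definition open_cone x A : set 'rV[R]_d :=
  [set x + t *: (y - x) | t in [set t : R | 0 < t < 1] & y in A].

(* Interior of a finite union of intersections of finitely many closed
   half-spaces: in particular the set lies on one side of its boundary
   (there are no cracks). *)
Definition polyhedral A :=
  exists P : seq (seq ('rV[R]_d * R)),
    A = interior [set x | has (all (fun h => dotv h.1 x <= h.2)) P].

Definition grad (phi : 'rV[R]_d -> R) x : 'rV[R]_d :=
  \row_i 'D_(delta_mx ord0 i) phi x.

Definition C1 (phi : 'rV[R]_d -> R) :=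
  (forall x, differentiable phi x) /\ continuous (grad phi).

Definition C1c_in A (phi : 'rV[R]_d -> R) :=
  C1 phi /\
  exists C, [/\ compact C, C `<=` A & forall x, ~ C x -> phi x = 0].

(* divV is the distributional divergence of V on A. *)
Definition weak_divergence A (V : 'rV[R]_d -> 'rV[R]_d) (divV : 'rV[R]_d -> R) :=
  forall phi, C1c_in A phi ->
    \int[lebesgue_rV R d]_(x in A) dotv (V x) (grad phi x) =
    - \int[lebesgue_rV R d]_(x in A) (divV x * phi x).

(* Isometric parametrization by R^(d-1) of the hyperplane through a spanned by
   the rows of B, when these rows are orthonormal. *)
Definition chart (a : 'rV[R]_d) (B : 'M[R]_(d.-1, d)) (y : 'rV[R]_d.-1) :
  'rV[R]_d := a + y *m B.

End euclidean.

Section discretization.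
Context (R : realType) (d : nat).

Record discretization (Omega : set 'rV[R]_d) := Discretization {
  cell : finType;
  face : finType;
  cell_set : cell -> set 'rV[R]_d;
  face_set : face -> set 'rV[R]_d;
  (* a + rowspace of an orthonormal frame: the hyperplane containing a face *)
  face_orig : face -> 'rV[R]_d;
  face_frame : face -> 'M[R]_(d.-1, d);
  faces_of : cell -> {set face};
  center : cell -> 'rV[R]_d;
  normal : cell -> face -> 'rV[R]_d;
  hyperplane := fun s => range (chart (face_orig s) (face_frame s));
  face_dom := fun s => chart (face_orig s) (face_frame s) @^-1` face_set s;
  cells_of := fun s => [set K | s \in faces_of K]%SET;

  cell_nonempty : forall K, cell_set K !=set0;
  cell_open : forall K, open (cell_set K);
  cell_connected : forall K, connected (cell_set K);
  cell_subset : forall K, cell_set K `<=` Omega;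
  cell_disjoint : trivIset setT cell_set;
  cell_cover : closure Omega = \bigcup_K closure (cell_set K);
  cell_vol_gt0 : forall K, 0 < vol (cell_set K);

  face_subset : forall s, face_set s `<=` closure Omega;
  face_disjoint : trivIset setT face_set;
  face_nonempty : forall s, face_set s !=set0;
  face_frame_orthonormal : forall s, face_frame s *m (face_frame s)^T = 1%:M;
  face_hyperplane : forall s, face_set s `<=` hyperplane s;
  face_open : forall s, open (face_dom s);
  face_area_gt0 : forall s, 0 < vol (face_dom s);
  cell_frontier : forall K,
    frontier (cell_set K) =
    \bigcup_(s in [set s | s \in faces_of K]) closure (face_set s);
  face_cells : forall s,
    (#|cells_of s| = 1%N /\ face_set s `<=` frontier Omega) \/
    #|cells_of s| = 2%N;

  center_in : forall K, cell_set K (center K);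
  center_star : forall K, star_shaped (center K) (cell_set K);
  center_dist_gt0 : forall K s, s \in faces_of K ->
    0 < edist (center K) (hyperplane s);

  normal_unit : forall K s, s \in faces_of K -> enorm (normal K s) = 1;
  normal_orthogonal : forall K s, s \in faces_of K ->
    face_frame s *m (normal K s)^T = 0;
  normal_outward : forall K s, s \in faces_of K ->
    forall x, face_set s x -> \forall t \near 0^'+,
      cell_set K (x - t *: normal K s) /\ ~ cell_set K (x + t *: normal K s);
}.

Context (Omega : set 'rV[R]_d) (D : discretization Omega).

Local Notation leb := (lebesgue_rV R d).
Local Notation leb1 := (lebesgue_rV R d.-1).
Local Notation fchart s := (chart (face_orig s) (face_frame s)).

Definition area (s : face D) : R := vol (face_dom s).

Definition face_integral (s : face D) (g : 'rV[R]_d -> R) : R :=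
  \int[leb1]_(y in face_dom s) g (fchart s y).

Definition barycenter (s : face D) : 'rV[R]_d :=
  \row_i ((area s)^-1 * face_integral s (fun x => x ord0 i)).

Definition dist_face (K : cell D) (s : face D) : R :=
  edist (center K) (hyperplane s).

Definition cell_cone (K : cell D) (s : face D) : set 'rV[R]_d :=
  open_cone (center K) (face_set s).

Definition exterior_face (s : face D) : bool := #|cells_of s| == 1%N.

Definition XD : Type := (cell D -> R) * (face D -> R).

Definition XD0 (v : XD) := forall s, exterior_face s -> v.2 s = 0.

Definition gradK (u : XD) (K : cell D) : 'rV[R]_d :=
  (vol (cell_set K))^-1 *:
  \sum_(s in faces_of K) (area s * (u.2 s - u.1 K)) *: normal K s.

Definition residual (u : XD) (K : cell D) (s : face D) : R :=
  Num.sqrt d%:R / dist_face K s *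
  (u.2 s - u.1 K - dotv (gradK u K) (barycenter s - center K)).

(* The cones are pairwise disjoint and cover Omega up to a null set. *)
Definition gradD (u : XD) (x : 'rV[R]_d) : 'rV[R]_d :=
  \sum_K \sum_(s in faces_of K)
    \1_(cell_cone K s) x *: (gradK u K + residual u K s *: normal K s).

Definition form_F (Lambda : 'rV[R]_d -> 'M[R]_d) (v u : XD) : R :=
  \int[leb]_(x in Omega) dotv (gradD v x) (gradD u x *m (Lambda x)^T).

(* g K s is the normal trace V . n_{K,s} on the face s, seen from K, of a
   bounded field V with square integrable divergence divV.  It is
   characterized, up to null sets of faces, by the Gauss-Green formula on K. *)
Definition is_normal_trace (V : 'rV[R]_d -> 'rV[R]_d) (divV : 'rV[R]_d -> R)
    (g : cell D -> face D -> 'rV[R]_d -> R) :=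
  forall K,
    (forall s, s \in faces_of K ->
       Lp_on leb1 +oo%E (face_dom s) (g K s \o fchart s)) /\
    (forall phi, C1 phi ->
       \int[leb]_(x in cell_set K)
         (dotv (V x) (grad phi x) + divV x * phi x) =
       \sum_(s in faces_of K) face_integral s (fun x => phi x * g K s x)).

(* Bounded fields with square integrable divergence do have a normal trace on
   the boundary of a polyhedral cell, so the default value 0 is never used. *)
Definition normal_trace V divV : cell D -> face D -> 'rV[R]_d -> R :=
  xget (fun _ _ _ => 0) [set g | is_normal_trace V divV g].

Definition flux V divV (K : cell D) (s : face D) : R :=
  face_integral s (normal_trace V divV K s).

Definition upwind V divV (u : XD) (K : cell D) (s : face D) : R :=
  if 0 <= flux V divV K s then u.1 K else u.2 s.

Definition form_T V divV (v u : XD) : R :=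
  \sum_K \sum_(s in faces_of K)
    (v.1 K - v.2 s) * flux V divV K s * upwind V divV u K s.

Definition cell_mean (f : 'rV[R]_d -> R) (K : cell D) : R :=
  (vol (cell_set K))^-1 * \int[leb]_(x in cell_set K) f x.

Definition source (q : 'rV[R]_d * measurableTypeR R -> R) (dt : R) (n : nat)
    (K : cell D) : R :=
  (dt * vol (cell_set K))^-1 *
  \int[lebesgue_measure]_(t in `](n.-1)%:R * dt, n%:R * dt[)
    \int[leb]_(x in cell_set K) q (x, t).

(* u n is the unknown u^n for 1 <= n <= N; u 0 is not used. *)
Definition discrete_solution (beta F : R -> R) Lambda V divV u0 q
    (dt : R) (N : nat) (u : nat -> XD) :=
  forall n, (1 <= n <= N)%N ->
    XD0 (u n) /\
    forall v, XD0 v ->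
      let previous K := if n == 1%N then cell_mean u0 K else (u n.-1).1 K in
      \sum_K vol (cell_set K) * v.1 K *
        ((beta ((u n).1 K) - beta (previous K)) / dt)
      + form_F Lambda v (u n) + form_T V divV v (u n)
      + \sum_K vol (cell_set K) * v.1 K * F ((u n).1 K)
      = \sum_K vol (cell_set K) * v.1 K * source q dt n K.

End discretization.

Section hypotheses.
Context (R : realType) (d : nat) (Omega : set 'rV[R]_d).
Local Notation leb := (lebesgue_rV R d).

Definition domain := [/\ bounded_set Omega, open Omega, connected Omega
                       & polyhedral Omega].

Definition hypothesis_beta (beta : R -> R) (beta_low : R) :=
  [/\ continuous beta, beta 0 = 0, {homo beta : x y / x < y},
      0 < beta_low /\
        (forall a b, beta_low * `|a - b| <= `|beta a - beta b|)
    & exists P C_beta beta_up,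
        [/\ 0 < P, forall u, `|u| <= P -> `|beta u| <= C_beta
          & beta_up.-lipschitz_[set u | P <= `|u|] beta]].

Definition hypothesis_Lambda (Lambda : 'rV[R]_d -> 'M[R]_d) :=
  [/\ forall i j, measurable_fun Omega (fun x => Lambda x i j),
      forall x, Omega x -> (Lambda x)^T = Lambda x
    & exists lambda_m lambda_M : 'rV[R]_d -> R,
        [/\ Lp_on leb +oo%E Omega lambda_m,
            Lp_on leb +oo%E Omega lambda_M,
            exists low up, 0 < low /\ {ae leb, forall x, Omega x ->
              low <= lambda_m x /\ lambda_m x <= lambda_M x /\ lambda_M x <= up}
          & {ae leb, forall x, Omega x -> forall a, eigenvalue (Lambda x) a ->
              lambda_m x <= a <= lambda_M x}]].

Definition hypothesis_V (V : 'rV[R]_d -> 'rV[R]_d) (divV : 'rV[R]_d -> R) :=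
  [/\ forall i, Lp_on leb 2%:E Omega (fun x => V x ord0 i),
      forall i, Lp_on leb +oo%E Omega (fun x => V x ord0 i),
      Lp_on leb 2%:E Omega divV,
      weak_divergence Omega V divV
    & {ae leb, forall x, Omega x -> 0 <= divV x}].

Definition hypothesis_u0 (u0 : 'rV[R]_d -> R) := Lp_on leb +oo%E Omega u0.

Definition hypothesis_F (F : R -> R) (F_low : R) :=
  [/\ continuous F, F 0 = 0,
      exists M L_F, [/\ 0 < M, forall u, u < 0 \/ M < u -> 0 < u * F u
        & L_F.-lipschitz_[set u | u < 0 \/ M < u] F],
      0 < F_low
    & forall u v, - F_low * (u - v) ^+ 2 <= (F u - F v) * (u - v)].

Definition hypothesis_q (T : R) (q : 'rV[R]_d * measurableTypeR R -> R) :=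
  Lp_on (leb \x (@lebesgue_measure R))%E 2%:E (Omega `*` `]0, T[) q.

End hypotheses.

(* Main.v *)
(* Each time step asks for a zero of u |-> (nonlinear diagonal part) + (linear
   part).  The nonlinear part f_K(s) = m(K) (beta(s) / dt + F(s) - ...) is
   strongly monotone because dt < beta_low / F_low.  The linear part is the
   bilinear form <v, u>_F + <v, u>_T, which is nonnegative on the diagonal:
   the first term because Lambda is positive semidefinite, the second because
   the fluxes of V are conservative across interior faces and have nonnegative
   sum over each cell.  No coercivity in the face unknowns is needed: perturbing
   by e times the identity in these unknowns gives a strongly monotone continuous
   map of R^n, which has a zero by induction on n and the intermediate value
   theorem; the limit e -> 0 exists since the cell unknowns stay bounded and
   linear ranges are closed.

   Conservation V_{K,s} + V_{L,s} = 0 comes from testing the distributional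
   divergence of V with C1 functions compactly supported in the union of K, s
   and L and increasing to 1 there; this union is an open subset of Omega because
   cells are star-shaped and Omega has no cracks. *)
Require Import Defs.
From HB Require Import structures.
From mathcomp Require Import all_boot all_order all_algebra.
From mathcomp Require Import all_classical all_reals all_analysis.
From mathcomp Require Import measurable_realfun ess_sup_inf ring lra.

Set Implicit Arguments.
Unset Strict Implicit.
Unset Printing Implicit Defensive.

Import Order.TTheory GRing.Theory Num.Theory.
Import numFieldNormedType.Exports.

Local Open Scope classical_set_scope.
Local Open Scope ring_scope.

(** * Euclidean product and continuity *)

(** The fluxes come from [normal_trace], which Gauss-Green pins down one cell at a time: nothing in
    it relates the two sides of an interior face. The only link is the weak divergence on [Omega],
    which accepts compactly supported test functions alone; hence the detour through cut-offs. They
    must converge at every point of the glued open set, not just almost everywhere, because the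
    shared face is null for the d-dimensional measure and yet carries the flux. The sign of the sum
    over one cell is cheaper: Gauss-Green on a cell accepts the constant 1. On the algebraic side,
    exterior faces keep a coordinate that is read as 0, so the matrix of the form is singular as
    soon as there is such a face. The estimate for the perturbed problems bounds e |r|^2 for the
    face part r, not r itself; this is exactly enough for the residue e r to vanish in the limit. *)

Section dot_product.
Context (R : realType).

Lemma dotvE n (x y : 'rV[R]_n) : dotv x y = \sum_i x ord0 i * y ord0 i.
Proof. by rewrite /dotv mxE; apply: eq_bigr => i _; rewrite mxE. Qed.

Lemma dotvC n (x y : 'rV[R]_n) : dotv x y = dotv y x.
Proof. by rewrite !dotvE; apply: eq_bigr => i _; rewrite mulrC. Qed.

Lemma dotvDl n (x y z : 'rV[R]_n) : dotv (x + y) z = dotv x z + dotv y z.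
Proof. by rewrite /dotv mulmxDl mxE. Qed.

Lemma dotvDr n (x y z : 'rV[R]_n) : dotv z (x + y) = dotv z x + dotv z y.
Proof. by rewrite dotvC dotvDl !(dotvC z). Qed.

Lemma dotvZl n a (x z : 'rV[R]_n) : dotv (a *: x) z = a * dotv x z.
Proof. by rewrite /dotv -scalemxAl mxE. Qed.

Lemma dotvZr n a (x z : 'rV[R]_n) : dotv z (a *: x) = a * dotv z x.
Proof. by rewrite dotvC dotvZl dotvC. Qed.

Lemma dotvNl n (x z : 'rV[R]_n) : dotv (- x) z = - dotv x z.
Proof. by rewrite -scaleN1r dotvZl mulN1r. Qed.

Lemma dotvNr n (x z : 'rV[R]_n) : dotv z (- x) = - dotv z x.
Proof. by rewrite dotvC dotvNl dotvC. Qed.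

Lemma dotvBl n (x y z : 'rV[R]_n) : dotv (x - y) z = dotv x z - dotv y z.
Proof. by rewrite dotvDl dotvNl. Qed.

Lemma dotvBr n (x y z : 'rV[R]_n) : dotv z (x - y) = dotv z x - dotv z y.
Proof. by rewrite dotvDr dotvNr. Qed.

Lemma dotv0l n (z : 'rV[R]_n) : dotv 0 z = 0.
Proof. by rewrite /dotv mul0mx mxE. Qed.

Lemma dotv0r n (z : 'rV[R]_n) : dotv z 0 = 0.
Proof. by rewrite dotvC dotv0l. Qed.

Lemma dotv_ge0 n (x : 'rV[R]_n) : 0 <= dotv x x.
Proof. by rewrite dotvE; apply: sumr_ge0 => i _; rewrite -expr2 sqr_ge0. Qed.

Lemma sqr_coord_le_dotv n (x : 'rV[R]_n) i : x ord0 i ^+ 2 <= dotv x x.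
Proof.
rewrite dotvE (bigD1 i) //= -expr2 lerDl.
by apply: sumr_ge0 => j _; rewrite -expr2 sqr_ge0.
Qed.

Lemma dotv_eq0 n (x : 'rV[R]_n) : dotv x x = 0 -> x = 0.
Proof.
move=> x0; apply/rowP => i; rewrite [RHS]mxE; apply/eqP; rewrite -sqrf_eq0 eq_le sqr_ge0.
by rewrite andbT -x0 sqr_coord_le_dotv.
Qed.

Lemma dotv_row_mx m n (x y : 'rV[R]_m) (z t : 'rV[R]_n) :
  dotv (row_mx x z) (row_mx y t) = dotv x y + dotv z t.
Proof. by rewrite /dotv tr_row_mx mul_row_col mxE. Qed.

Lemma cauchy_schwarz n (x y : 'rV[R]_n) :
  dotv x y ^+ 2 <= dotv x x * dotv y y.
Proof.
have [->|y0] := eqVneq y 0; first by rewrite !dotv0r mulr0 expr2 mulr0.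
have yy : 0 < dotv y y.
  by rewrite lt0r dotv_ge0 andbT; apply: contra_neq y0; exact: dotv_eq0.
have := dotv_ge0 (dotv y y *: x - dotv x y *: y).
rewrite !(dotvBl, dotvBr, dotvZl, dotvZr) (dotvC y x) => h.
have {h} : 0 <= dotv y y * (dotv x x * dotv y y - dotv x y ^+ 2) by lra.
by rewrite pmulr_rge0 // subr_ge0.
Qed.

(** Cauchy-Schwarz against each column; the constant is the squared Frobenius norm of [B]. *)
Lemma dotv_mulmx_le m n (B : 'M[R]_(m, n)) :
  exists2 C, 0 <= C & forall x, dotv (x *m B) (x *m B) <= C * dotv x x.
Proof.
exists (\sum_j dotv (row j B^T) (row j B^T)) => [|x].
  by apply: sumr_ge0 => j _; exact: dotv_ge0.
rewrite [leLHS]dotvE mulr_suml; apply: ler_sum => j _.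
rewrite -expr2 mulrC.
suff -> : (x *m B) ord0 j = dotv x (row j B^T) by exact: cauchy_schwarz.
by rewrite dotvE mxE; apply: eq_bigr => i _; rewrite !mxE.
Qed.

Section continuity_at.
Context (T : topologicalType) (x : T).

Lemma cont_cst (U : topologicalType) (u : U) : (fun _ : T => u) @ x --> u.
Proof. exact: cvg_cst. Qed.

Lemma cont_id : (fun t : T => t) @ x --> x.
Proof. exact: cvg_id. Qed.

Lemma contD (U : pseudoMetricNormedZmodType R) (f g : T -> U) :
  f @ x --> f x -> g @ x --> g x -> (fun t => f t + g t) @ x --> f x + g x.
Proof. exact: cvgD. Qed.

Lemma contN (U : pseudoMetricNormedZmodType R) (f : T -> U) :
  f @ x --> f x -> (fun t => - f t) @ x --> - f x.
Proof. exact: cvgN. Qed.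

Lemma contB (U : pseudoMetricNormedZmodType R) (f g : T -> U) :
  f @ x --> f x -> g @ x --> g x -> (fun t => f t - g t) @ x --> f x - g x.
Proof. exact: cvgB. Qed.

Lemma contM (f g : T -> R) :
  f @ x --> f x -> g @ x --> g x -> (fun t => f t * g t) @ x --> f x * g x.
Proof. exact: cvgM. Qed.

Lemma contV (f : T -> R) : f x != 0 ->
  f @ x --> f x -> (fun t => (f t)^-1) @ x --> (f x)^-1.
Proof. by move=> ?; apply: cvgV. Qed.

Lemma contZ (U : normedModType R) (f : T -> R) (g : T -> U) :
  f @ x --> f x -> g @ x --> g x -> (fun t => f t *: g t) @ x --> f x *: g x.
Proof. exact: cvgZ. Qed.

End continuity_at.

Lemma cvg_rV (T : topologicalType) n (f : T -> 'rV[R]_n) x :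
  (forall i, (fun t => f t ord0 i) @ x --> f x ord0 i) -> f @ x --> f x.
Proof.
move=> fx; apply/cvg_ballP => e e0.
have : \forall t \near x, forall i, ball (f x ord0 i) e (f t ord0 i).
  by apply: filter_forall => i; exact: (cvg_ball (fx i)).
by apply: filterS => t ft; split=> // i j; rewrite !ord1.
Qed.

Lemma continuous_dotv (T : topologicalType) n (f g : T -> 'rV[R]_n) x :
  f @ x --> f x -> g @ x --> g x ->
  (fun t => dotv (f t) (g t)) @ x --> dotv (f x) (g x).
Proof.
move=> fx gx; rewrite dotvE; under eq_fun do rewrite dotvE.
have coordP (h : T -> 'rV[R]_n) i : h @ x --> h x ->
    (fun t => h t ord0 i) @ x --> h x ord0 i.
  by move=> hx; apply: (continuous_cvg _ (@coord_continuous _ _ _ _ _ _) hx).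
by apply: cvg_big => [|i _]; [exact: add_continuous|]; apply: cvgM; exact: coordP.
Qed.

Lemma continuous_mulmx (T : topologicalType) m n (f : T -> 'rV[R]_m)
    (A : 'M[R]_(m, n)) x :
  f @ x --> f x -> (fun t => f t *m A) @ x --> f x *m A.
Proof.
move=> fx; apply: (@cvg_rV _ _ (fun t => f t *m A)) => j.
rewrite mxE; under eq_fun do rewrite mxE.
apply: cvg_big => [|i _]; [exact: add_continuous|]; apply: cvgM; last exact: cvg_cst.
exact: (continuous_cvg _ (@coord_continuous _ _ _ _ _ _) fx).
Qed.

Lemma cvg_row_mx (T : topologicalType) m n (f : T -> 'rV[R]_m)
    (g : T -> 'rV[R]_n) x :
  f @ x --> f x -> g @ x --> g x ->
  (fun t => row_mx (f t) (g t)) @ x --> row_mx (f x) (g x).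
Proof.
move=> fx gx; apply: (@cvg_rV _ _ (fun t => row_mx (f t) (g t))) => j.
rewrite mxE; under eq_fun do rewrite mxE.
case: (fintype.split j) => i.
  exact: (continuous_cvg _ (@coord_continuous _ _ _ _ _ _) fx).
exact: (continuous_cvg _ (@coord_continuous _ _ _ _ _ _) gx).
Qed.

End dot_product.

(** * Monotone equations *)

Section monotone_operators.
Context (R : realType).

(** Comparing with the point 0 gives [g M >= g 0 + c * M] and [g (- M) <= g 0 - c * M], so the sign
    changes once [c * M] exceeds [|g 0|]. The [+ 1] in [M] keeps it positive when [g 0 = 0]. *)
Lemma strongly_monotone_IVT (g : R -> R) (c : R) : 0 < c -> continuous g ->
  (forall s t : R, c * (s - t) ^+ 2 <= (g s - g t) * (s - t)) -> exists t, g t = 0.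
Proof.
move=> c0 cg mg; pose M := `|g 0| / c + 1.
have M0 : 0 < M by rewrite ltr_pwDr// divr_ge0// ltW.
have cM : `|g 0| < c * M.
  by rewrite /M mulrDr mulr1 mulrCA divff ?gt_eqF// mulr1 ltrDl.
have gM : 0 <= g M.
  have := mg M 0; rewrite subr0 expr2 mulrA ler_pM2r// => h.
  have := ler_norm (- g 0); rewrite normrN; lra.
have gNM : g (- M) <= 0.
  have := mg 0 (- M); rewrite sub0r opprK expr2 mulrA ler_pM2r// => h.
  have := ler_norm (g 0); lra.
have MM : - M <= M by lra.
have [||t _ gt] := @IVT R g (- M) M 0 MM; last by exists t.
  exact: continuous_subspaceT.
by rewrite ge_min le_max gM gNM orbT.
Qed.

(* Freezing the first coordinate at t leaves a strongly monotone map, with a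
   zero y t that is continuous in t; what remains is a scalar equation. *)
Lemma strongly_monotone_zero n (G : 'rV[R]_n -> 'rV[R]_n) (c : R) :
  0 < c -> continuous G ->
  (forall x y : 'rV[R]_n, c * dotv (x - y) (x - y) <= dotv (G x - G y) (x - y)) ->
  exists x, G x = 0.
Proof.
move=> c0; elim: n G => [G _ _|n IH]; first by exists 0; apply/rowP => -[].
rewrite -[n.+1]/(1 + n)%N => G cG mG.
pose cons (t : R) (y : 'rV[R]_n) : 'rV[R]_(1 + n) := row_mx (const_mx t) y.
pose H t y : 'rV[R]_n := rsubmx (G (cons t y)).
pose h t y : R := (lsubmx (G (cons t y)) : 'rV[R]_1) ord0 ord0.
have GE t y : G (cons t y) = row_mx (const_mx (h t y)) (H t y).
  rewrite -[LHS]hsubmxK; congr row_mx.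
  by apply/rowP => i; rewrite (ord1 i) [RHS]mxE.
have dotG t s y z :
    dotv (G (cons t y) - G (cons s z)) (cons t y - cons s z) =
    (h t y - h s z) * (t - s) + dotv (H t y - H s z) (y - z).
  rewrite !GE /cons !(opp_row_mx, add_row_mx) dotv_row_mx; congr (_ + _).
  by rewrite dotvE big_ord1 !mxE.
have dotc t s y z :
    dotv (cons t y - cons s z) (cons t y - cons s z) =
    (t - s) ^+ 2 + dotv (y - z) (y - z).
  rewrite /cons !(opp_row_mx, add_row_mx) dotv_row_mx; congr (_ + _).
  by rewrite dotvE big_ord1 !mxE.
have ccons (S : topologicalType) (f : S -> R) (g : S -> 'rV[R]_n) x :
    f @ x --> f x -> g @ x --> g x ->
    (fun t => G (cons (f t) (g t))) @ x --> G (cons (f x) (g x)).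
  move=> fx gx; apply: continuous_cvg; first exact: cG.
  apply: (@cvg_row_mx _ _ _ _ (fun t => const_mx (f t))) => //.
  apply: (@cvg_rV _ _ _ (fun t => const_mx (f t))) => i.
  by rewrite mxE; under eq_fun do rewrite mxE.
have cH (S : topologicalType) (f : S -> R) (g : S -> 'rV[R]_n) x :
    f @ x --> f x -> g @ x --> g x ->
    (fun t => H (f t) (g t)) @ x --> H (f x) (g x).
  move=> fx gx; apply: (@cvg_rV _ _ _ (fun t => H (f t) (g t))) => i.
  rewrite mxE; under eq_fun do rewrite mxE.
  exact: (continuous_cvg _ (@coord_continuous _ _ _ _ _ _) (ccons _ _ _ _ fx gx)).
have /choice[y yP] : forall t, exists y, H t y = 0.
  move=> t; have cHt (z : 'rV[R]_n) : (fun y => H t y) @ z --> H t z.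
    have c1 : (fun _ : 'rV[R]_n => t) @ z --> t.
      exact: (@cvg_cst _ t _ _ (nbhs_filter z)).
    have c2 : (fun y : 'rV[R]_n => y) @ z --> z by exact: cvg_id.
    exact: (cH _ _ _ _ c1 c2).
  apply: IH => [|z z']; first exact: cHt.
  by have := mG (cons t z) (cons t z'); rewrite dotc dotG !subrr mulr0 expr0n /= !add0r.
(* Strong monotonicity on the slice at [t], between [y t] and [y s], bounds c |y s - y t| by the
   norm of [H s (y s) - H t (y s)]. Only the first argument moves there, so continuity of [H]
   suffices. *)
have cy : continuous y.
  move=> s; apply: cvg_rV => i.
  pose r t := Num.sqrt (dotv (H s (y s) - H t (y s)) (H s (y s) - H t (y s))) / c.
  have rs : r t @[t --> s] --> (0 : R).
    have -> : (0 : R) = r s by rewrite /r subrr dotv0l sqrtr0 mul0r.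
    apply: cvgM; last exact: cvg_cst.
    apply: continuous_cvg; first exact: sqrt_continuous.
    have cd : (fun t => H s (y s) - H t (y s)) @ s --> H s (y s) - H s (y s).
      apply: cvgB; first exact: cvg_cst.
      have c1 : (fun t : R => t) @ s --> s by exact: cvg_id.
      have c2 : (fun _ : R => y s) @ s --> y s by exact: cvg_cst.
      exact: (cH _ _ _ _ c1 c2).
    exact: (@continuous_dotv _ _ _ (fun t => H s (y s) - H t (y s))
      (fun t => H s (y s) - H t (y s)) s cd cd).
  have key t : `|y s ord0 i - y t ord0 i| <= r t.
    rewrite /r ler_pdivlMr//; set D := _ - H t (y s).
    have := mG (cons t (y t)) (cons t (y s)).
    rewrite dotc dotG subrr mulr0 expr0n /= !add0r yP -(yP s) => yts.
    have /(_ D (y t - y s)) := @cauchy_schwarz R n.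
    have := sqr_coord_le_dotv (y t - y s) i.
    rewrite !mxE distrC; set a := (_ - y s ord0 i).
    move: yts; set N := dotv (y t - y s) _; set E := dotv D (y t - y s) => yts aN EN.
    rewrite -[leLHS]ger0_norm ?mulr_ge0 ?(ltW c0)// -sqrtr_sqr ler_wsqrtr//.
    rewrite exprMn real_normK ?num_real//.
    have N0 : 0 <= N by exact: dotv_ge0.
    have [N1|Npos] := leP N 0.
      have -> : a ^+ 2 = 0 by apply/eqP; rewrite eq_le sqr_ge0 andbT; lra.
      by rewrite mul0r dotv_ge0.
    have cN : (c * N) ^+ 2 <= dotv D D * N.
      apply: le_trans EN; rewrite ler_sqr ?nnegrE//.
        by rewrite mulr_ge0// ltW.
      by apply: le_trans yts; rewrite mulr_ge0// ltW.
    have {}cN : c ^+ 2 * N <= dotv D D.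
      by rewrite -(ler_pM2r Npos) -mulrA -expr2 -exprMn.
    apply: le_trans cN; rewrite mulrC ler_pM2l// exprn_gt0//.
  apply/cvgrPdist_le => e e0.
  have /cvgrPdist_le/(_ e e0) := rs; apply: filterS => t.
  rewrite sub0r normrN => /(le_trans (ler_norm _)); exact: le_trans (key t).
(* Along the curve [(t, y t)] the [H] components vanish, so the scalar product reduces to its first
   term and [h t (y t)] inherits the constant [c]. *)
have [|s t|t ht] := @strongly_monotone_IVT (fun t => h t (y t)) c c0.
- move=> s; rewrite /h.
  have := ccons _ id y s cvg_id (cy s).
  have lc : continuous (fun z : 'rV[R]_(1 + n) =>
      (lsubmx z : 'rV[R]_1) ord0 ord0).
    move=> z; rewrite /continuous_at mxE; under eq_fun do rewrite mxE.
    exact: coord_continuous.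
  exact: (continuous_cvg _ (lc _)).
- have := mG (cons s (y s)) (cons t (y t)).
  rewrite dotc dotG !yP subrr dotv0l addr0; apply: le_trans.
  by rewrite ler_pM2l// lerDl dotv_ge0.
- exists (cons t (y t)); rewrite GE ht yP.
  by rewrite -[RHS]hsubmxK; congr row_mx; apply/rowP => i; rewrite !mxE.
Qed.


(* Perturbing the equations of the last n unknowns by e *: rsubmx u restores
   strong monotonicity; as e tends to 0 the first m unknowns stay in a compact
   set, and the range of u |-> (lsubmx u, u *m A) is closed. *)
Lemma monotone_zero m n (A : 'M[R]_(m + n)) (f : 'I_m -> R -> R) (c : R) :
  0 < c -> (forall x, 0 <= dotv (x *m A) x) -> (forall i, continuous (f i)) ->
  (forall i (s t : R), c * (s - t) ^+ 2 <= (f i s - f i t) * (s - t)) ->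
  exists u : 'rV[R]_(m + n),
    row_mx (\row_i f i (lsubmx u ord0 i)) 0 + u *m A = 0.
Proof.
move=> c0 mA cf mf.
pose fr (x : 'rV[R]_m) : 'rV[R]_m := \row_i f i (x ord0 i).
have cfr : continuous fr.
  move=> x; apply: cvg_rV => i; rewrite mxE; under eq_fun do rewrite mxE.
  have cx := @coord_continuous R 1 m ord0 i x.
  exact: (continuous_cvg _ (cf i _) cx).
have mfr x y : c * dotv (x - y) (x - y) <= dotv (fr x - fr y) (x - y).
  rewrite !dotvE mulr_sumr; apply: ler_sum => i _; rewrite !mxE -expr2; exact: mf.
pose G e u := row_mx (fr (lsubmx u)) (e *: rsubmx u) + u *m A.
have dotG e (u v : 'rV[R]_(m + n)) :
    dotv (fr (lsubmx u) - fr (lsubmx v)) (lsubmx u - lsubmx v)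
    + e * dotv (rsubmx u - rsubmx v) (rsubmx u - rsubmx v)
    <= dotv (G e u - G e v) (u - v).
  rewrite /G opprD addrACA -mulmxBl opp_row_mx add_row_mx -scalerBr.
  rewrite [leRHS]dotvDl -[leLHS]addr0; apply: lerD; last exact: mA.
  have -> : u - v = row_mx (lsubmx u - lsubmx v) (rsubmx u - rsubmx v).
    by rewrite -!raddfB hsubmxK.
  by rewrite dotv_row_mx dotvZl.
have /choice[s sP] : forall e : R, exists u, 0 < e -> G e u = 0.
  move=> e; have [e0|e0] := ltP 0 e; last by exists 0.
  have cG (x : 'rV[R]_(m + n)) : G e @ x --> G e x.
    rewrite /G; apply: cvgD.
    - exact: nbhs_filter.
    - apply: (@cvg_row_mx _ _ _ _ (fun z => fr (lsubmx z)) (fun z => e *: rsubmx z)).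
        have lc : lsubmx z @[z --> x] --> lsubmx x.
          apply: (@cvg_rV _ _ _ (fun z : 'rV[R]_(m + n) => lsubmx z)) => i.
          rewrite mxE; under eq_fun do rewrite mxE.
          exact: coord_continuous.
        exact: (continuous_cvg _ (cfr _) lc).
      apply: (@cvg_rV _ _ _ (fun z : 'rV[R]_(m + n) => e *: rsubmx z)) => i.
      rewrite !mxE; under eq_fun do rewrite !mxE.
      by apply: contM; [exact: cont_cst|exact: coord_continuous].
    - by apply: continuous_mulmx; exact: cvg_id.
  have [|x|x y|u u0] := @strongly_monotone_zero _ (G e) (Num.min c e).
  - by rewrite lt_min c0.
  - exact: cG.
  - apply: le_trans (dotG e x y).
    have -> : x - y = row_mx (lsubmx x - lsubmx y) (rsubmx x - rsubmx y).
      by rewrite -!raddfB hsubmxK.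
    rewrite dotv_row_mx mulrDr.
    apply: lerD; last by rewrite ler_wpM2r ?dotv_ge0// ge_min lexx orbT.
    apply: le_trans (mfr _ _).
    by rewrite ler_wpM2r ?dotv_ge0// ge_min lexx.
  by exists u.
(* Comparing [s e] with 0 gives c |x|^2 + e |r|^2 <= - <fr 0, x>; the square of [c *: x + fr 0]
   absorbs the right-hand side (Young's inequality) and leaves bounds independent of e. *)
pose B := dotv (fr 0) (fr 0) / c.
have bound (e : R) : 0 < e ->
    dotv (lsubmx (s e)) (lsubmx (s e)) <= B / c /\
    e * dotv (rsubmx (s e)) (rsubmx (s e)) <= B.
  move=> e0; have := dotG e (s e) 0.
  have l0 : lsubmx (0 : 'rV[R]_(m + n)) = 0 by apply/rowP => i; rewrite !mxE.
  have r0 : rsubmx (0 : 'rV[R]_(m + n)) = 0 by apply/rowP => i; rewrite !mxE.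
  have -> : G e 0 = row_mx (fr 0) 0 by rewrite /G mul0mx addr0 l0 r0 scaler0.
  rewrite (sP e e0) l0 r0 !subr0 sub0r.
  set x := lsubmx _; set r := rsubmx _.
  have := mfr x 0; rewrite !subr0.
  rewrite -[s e]hsubmxK -/x -/r opp_row_mx dotv_row_mx oppr0 dotv0l addr0.
  rewrite dotvNl.
  have := dotv_ge0 (c *: x + fr 0); have := dotv_ge0 (e *: r).
  rewrite !(dotvDl, dotvDr, dotvZl, dotvZr) (dotvC x) /B.
  set X := dotv x x; set Y := dotv (fr 0) x; set Z := dotv (fr 0) (fr 0).
  set W := dotv (fr x - fr 0) x; set Q := dotv r r => eQ h1 h2 h3.
  have X0 : 0 <= X by exact: dotv_ge0.
  have Q0 : 0 <= Q by exact: dotv_ge0.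
  have Z0 : 0 <= Z by exact: dotv_ge0.
  have cX0 : 0 <= c * X by rewrite mulr_ge0// ltW.
  have eQ0 : 0 <= e * Q by rewrite mulr_ge0// ltW.
  have h4 : c * X + e * Q <= - Y by lra.
  have h5 : - Y * c *+ 2 <= c * (c * X) + Z by lra.
  have h6 : c * (c * X) + 2 * (c * (e * Q)) <= Z.
    have : c * (c * X + e * Q) <= c * - Y by rewrite ler_pM2l.
    lra.
  have ccX : 0 <= c * (c * X) by rewrite mulr_ge0// ltW.
  have ceQ : 0 <= c * (e * Q) by rewrite mulr_ge0// ltW.
  by split; rewrite !ler_pdivlMr//; lra.
pose P : 'M[R]_(m + n, m) := col_mx 1%:M 0.
have uP (u : 'rV[R]_(m + n)) : u *m P = lsubmx u.
  by rewrite -{1}[u]hsubmxK mul_row_col mulmx1 mulmx0 addr0.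
(* Multiplying by [M] returns both the cell part of [u] and [u *m A]. Hence [y x] lies in the row
   space of [M] exactly when some [u] with cell part [x] solves the system: the last n unknowns are
   eliminated. *)
pose M : 'M[R]_(m + n, m + (m + n)) := row_mx P A.
pose y x : 'rV[R]_(m + (m + n)) := row_mx x (- row_mx (fr x) 0).
suff [x yM] : exists x, (y x <= M)%MS.
  have [u] := submxP yM; rewrite /y /M mul_mx_row uP => /eq_row_mx[xu fu].
  by exists u; rewrite -xu -fu subrr.
(* Row-space membership is the vanishing of the product with [cokermx M], a continuous condition on
   [x]; this is the closedness of linear ranges. *)
pose h x := dotv (y x *m cokermx M) (y x *m cokermx M).
have [C C0 CP] := dotv_mulmx_le (row_mx 0 (row_mx 0 1%:M) *m cokermx M
  : 'M[R]_(n, _)).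
(* [y x] differs from [s e *m M], which the cokernel kills, by [e *: r] in the last block; so [h] is
   at most C e^2 |r|^2, and one factor e is spent on the bound of e |r|^2. *)
have hs (e : R) : 0 < e -> h (lsubmx (s e)) <= e * (C * B).
  move=> e0; set x := lsubmx _; set r := rsubmx (s e).
  have -> : h x = e * (e * dotv (r *m (row_mx 0 (row_mx 0 1%:M) *m cokermx M))
                                (r *m (row_mx 0 (row_mx 0 1%:M) *m cokermx M))).
    have yE : y x = s e *m M + e *: row_mx 0 (row_mx 0 r).
      rewrite /M mul_mx_row uP !scale_row_mx !scaler0 add_row_mx addr0 -/x.
      congr row_mx; have := sP e e0; rewrite /G -/x -/r => /eqP.
      rewrite addrC addr_eq0 => /eqP ->.
      by rewrite !opp_row_mx add_row_mx oppr0 addr0 addNr.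
    have kE : y x *m cokermx M =
        e *: (r *m (row_mx 0 (row_mx 0 1%:M) *m cokermx M)).
      rewrite yE mulmxDl -mulmxA mulmx_coker mulmx0 add0r -scalemxAl.
      by rewrite (mulmxA r _ (cokermx M)) !mul_mx_row !mulmx0 mulmx1.
    by rewrite /h kE dotvZl dotvZr.
  rewrite ler_pM2l//; have [_ rB] := bound e e0.
  apply: (@le_trans _ _ (e * (C * dotv r r))); first by rewrite ler_pM2l.
  by rewrite mulrCA ler_wpM2l.
(* A coordinate with square at most [B / c] has absolute value at most [B / c + 1]; no square root
   is required. *)
pose X := B / c + 1.
pose K := [set x : 'rV[R]_m | forall i, `[- X, X]%classic (x ord0 i)].
have Ks (e : R) : 0 < e -> K (lsubmx (s e)).
  move=> e0 i; have [xB _] := bound e e0.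
  have := le_trans (sqr_coord_le_dotv (lsubmx (s e)) i) xB.
  rewrite /= in_itv /=; set a := _ ord0 i => aB.
  have := sqr_ge0 (a - 1); have := sqr_ge0 (a + 1).
  by rewrite /X => ? ?; apply/andP; split; nra.
(* Minimizing [h] over the box replaces the extraction of a convergent subsequence: the minimum is
   below [h (lsubmx (s e))] for every e > 0, hence 0. *)
have [|||x0 _ x0P] := @EVT_min_rV _ _ h K.
- by exists (lsubmx (s 1)); exact: Ks.
- apply: (@rV_compact _ m (fun=> `[- X, X]%classic)) => i.
  exact: segment_compact.
- apply: continuous_subspaceT => x.
  have cy : (fun x => y x *m cokermx M) @ x --> y x *m cokermx M.
    apply: continuous_mulmx.
    apply: (@cvg_row_mx _ _ _ _ id (fun x => - row_mx (fr x) 0)); first exact: cont_id.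
    apply: (@contN _ _ _ _ (fun x => row_mx (fr x) 0)).
    apply: (@cvg_row_mx _ _ _ _ fr (fun=> 0)); first exact: cfr.
    exact: cont_cst.
  exact: (continuous_dotv cy cy).
have hx0 : h x0 = 0.
  apply/eqP; rewrite eq_le dotv_ge0 andbT; apply/ler_addgt0Pr => e e0; rewrite add0r.
  have CB : 0 <= C * B by rewrite mulr_ge0// divr_ge0 ?dotv_ge0// ltW.
  pose e' := e / (C * B + 1).
  have e'0 : 0 < e' by rewrite divr_gt0// ltr_wpDl.
  apply: le_trans (x0P _ _) (le_trans (hs e' e'0) _); first by rewrite inE; exact: Ks.
  by rewrite /e' mulrAC ler_pdivrMr ?ltr_wpDl// ler_pM2l// lerDl.
by exists x0; rewrite submxE; apply/eqP; exact: dotv_eq0.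
Qed.

End monotone_operators.

(** * Lebesgue measure on row vectors *)

Section rational_balls.
Context (R : realType) (n : nat).
Implicit Types (U : set 'rV[R]_n) (x : 'rV[R]_n).

(** Squared and Euclidean, hence a polynomial in the coordinates: it is measurable and, later, of
    class C1. Rational centers make the balls countable. *)
Definition sqdist_to (a : 'rV[rat]_n) x : R :=
  dotv (x - map_mx ratr a) (x - map_mx ratr a).

(** The point is strictly inside while the closed ball stays in [U]: strictness makes the bump
    positive at [x], closedness gives it a compact support inside [U]. *)
Lemma rational_ball U x : open U -> U x ->
  exists (a : 'rV[rat]_n) (r : rat), sqdist_to a x < ratr r /\
    forall y, sqdist_to a y <= ratr r -> U y.
Proof.
move=> oU Ux; have /nbhs_ballP[e /= e0 eU] : nbhs x U by exact: open_nbhs_nbhs.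
have /rat_in_itvoo[s] : 0 < e / 2 by rewrite divr_gt0.
rewrite in_itv /= => /andP[s0 se].
(* Approximating each coordinate within [t] gives a squared distance at most [n * t ^+ 2], which is
   below [s' ^+ 2] because n < (n + 1)^2. Then s' < e / 2 and the triangle inequality reach the
   sup-norm ball of radius e. *)
set s' : R := ratr s in s0 se *; pose t : R := s' / n.+1%:R.
have t0 : 0 < t by rewrite divr_gt0.
have ts : t <= s' by rewrite ler_pdivrMr// ler_pMr// ler1n.
have /choice[a aP] : forall i, exists q : rat,
    `|x ord0 i - ratr q| < t.
  move=> i; have : x ord0 i - t < x ord0 i + t by lra.
  move=> /rat_in_itvoo[q]; rewrite in_itv /= => /andP[q1 q2]; exists q.
  by rewrite ltr_norml; apply/andP; split; lra.
exists (\row_i a i), (s ^+ 2); split=> [|y].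
  rewrite /sqdist_to dotvE rmorphXn /= -/s'.
  apply: (@le_lt_trans _ _ (\sum_(i < n) t ^+ 2)).
    apply: ler_sum => i _; rewrite !mxE -expr2 -real_normK ?num_real//.
    by rewrite ler_sqr ?nnegrE// ltW// aP.
  rewrite sumr_const card_ord -mulr_natl expr_div_n mulrCA.
  rewrite -[ltRHS]mulr1 ltr_pM2l ?exprn_gt0// ltr_pdivrMr ?exprn_gt0// mul1r.
  rewrite -natrX ltr_nat; apply: (@leq_trans n.+1) => //.
  by rewrite expnS leq_pmulr// expn_gt0.
rewrite rmorphXn /= -/s' => ys; apply: eU; split=> // i j; rewrite (ord1 i) {i}.
have := le_trans (sqr_coord_le_dotv _ j) ys; rewrite !mxE.
rewrite -[leLHS]real_normK ?num_real// ler_sqr ?nnegrE ?(ltW s0)// => yj.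
change (`|x ord0 j - y ord0 j| < e).
have := ler_distD (ratr (a j)) (x ord0 j) (y ord0 j).
by rewrite (distrC (ratr _)); have := aP j; lra.
Qed.

Lemma measurable_dotv d (T : measurableType d) (D : set T) (f g : T -> 'rV[R]_n) :
  (forall i, measurable_fun D (fun t => f t ord0 i)) ->
  (forall i, measurable_fun D (fun t => g t ord0 i)) ->
  measurable_fun D (fun t => dotv (f t) (g t)).
Proof.
move=> mf mg; under eq_fun do rewrite dotvE.
by apply: measurable_sum => i; exact: measurable_funM.
Qed.

Lemma measurable_sqdist_to a : measurable_fun [set: 'rV[R]_n] (sqdist_to a).
Proof.
have mc i : measurable_fun [set: 'rV[R]_n]
    (fun x => (x - map_mx ratr a) ord0 i : measurableTypeR R).
  under eq_fun do rewrite mxE.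
  by apply: measurable_funD => //; exact: measurable_rV_coord.
exact: measurable_dotv.
Qed.

(** The sigma-algebra is generated by the coordinates, not by open sets, so [U] is written as a
    countable union of rational balls, each measurable through [sqdist_to]. *)
Lemma open_measurable_rV U : open U -> measurable U.
Proof.
move=> oU.
pose F (p : 'rV[rat]_n * rat) : set 'rV[R]_n :=
  if pselect (forall y, sqdist_to p.1 y <= ratr p.2 -> U y)
  then [set y | sqdist_to p.1 y < ratr p.2] else set0.
rewrite (_ : U = \bigcup_p F p).
  apply: countable_bigcupT_measurable; first exact: countableP.
  move=> p; rewrite /F; case: pselect => h /=; last exact: measurable0.
  rewrite -[X in measurable X]setTI.
  by apply: measurable_fun_ltr => //; exact: measurable_sqdist_to.
apply/seteqP; split=> [x Ux|x [p _]]; last first.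
  by rewrite /F; case: pselect => //= pU /ltW; exact: pU.
have [a [r [xr rU]]] := rational_ball oU Ux.
by exists (a, r) => //; rewrite /F; case: pselect.
Qed.

Lemma continuous_measurable_rV (f : 'rV[R]_n -> R) :
  continuous f -> measurable_fun [set: 'rV[R]_n] f.
Proof.
move=> /continuousP cf; apply: (measurability _ (RGenOpens.measurableE R)).
move=> _ [_ [a [b ->] <-]]; rewrite setTI; apply: open_measurable_rV.
exact/cf/interval_open.
Qed.

Lemma bounded_finite_measure U : bounded_set U -> measurable U ->
  (lebesgue_rV R n U < +oo)%E.
Proof.
move=> [M [_ /(_ (M + 1))]]; rewrite ltrDl ltr01 => /(_ isT) UM mU.
pose B := [set x : 'rV[R]_n | forall i, `[- (M + 1), M + 1]%classic (x ord0 i)].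
have mB : measurable B.
  rewrite (_ : B = \bigcap_(i : 'I_n)
    ((fun x => x ord0 i : measurableTypeR R) @^-1` `[- (M + 1), M + 1]%classic)).
    apply: fin_bigcap_measurable => // i _; rewrite -[X in measurable X]setTI.
    by apply: measurable_rV_coord => //.
  by apply/seteqP; split=> [x Bx i _|x Bx i]; [exact: Bx|exact: (Bx i)].
apply: (@le_lt_trans _ _ (lebesgue_rV R n B)).
  apply: le_measure; rewrite ?inE// => x Ux i.
  rewrite /= in_itv /= -ler_norml; apply: le_trans (UM _ Ux).
  by rewrite [leRHS]mx_normrE; apply: (le_bigmax _ _ (ord0, i)).
rewrite (lebesgue_rV_box (I := fun=> `[- (M + 1), M + 1]%classic)) //.
rewrite (eq_bigr (fun=> (fine (lebesgue_measure `[- (M + 1), M + 1]%classic))%:E)).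
  by rewrite prodEFin ltry.
move=> i _; rewrite fineK//= lebesgue_measure_itv /=; case: ifPn => //.
Qed.

End rational_balls.

(** Induction along the iterated product. If the first coefficient of [a] is 0, the set is a line
    times a hyperplane of lower dimension; otherwise each section in the first variable is a single
    point. *)
Lemma hyperplane_null (R : realType) n (a : 'rV[R]_n) c : a != 0 ->
  lebesgue_rV R n [set x | dotv a x = c] = 0%E.
Proof.
have mH m (b : 'rV[R]_m) (e : R) : measurable [set x | dotv b x = e].
  have -> : [set x | dotv b x = e] = (dotv b) @^-1` [set e] by [].
  rewrite -[X in measurable X]setTI; apply: measurable_dotv => // i.
  exact: measurable_rV_coord.
elim: n a c => [a|n IH a c a0].
  by move=> c; rewrite (_ : a = 0) ?eqxx//; apply/rowP => -[].
rewrite /= /lebesgue_rV_succ /pushforward.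
pose a' : 'rV[R]_n := rsubmx (a : 'rV[R]_(1 + n)).
have dE (p : measurableTypeR R * 'rV[R]_n) :
    dotv a (rV_cons p) = a ord0 ord0 * p.1 + dotv a' p.2.
  transitivity (dotv (row_mx (lsubmx (a : 'rV[R]_(1 + n))) a')
      (row_mx (p.1 : R)%:M p.2 : 'rV[R]_(1 + n))); first by rewrite /a' hsubmxK.
  rewrite dotv_row_mx; congr (_ + _).
  rewrite dotvE big_ord1 !mxE mulr1n; congr (a _ _ * _).
  exact/val_inj.
have [a00|a00] := eqVneq (a ord0 ord0) 0.
  have -> : (@rV_cons R n) @^-1` [set x | dotv a x = c] =
      setT `*` [set x | dotv a' x = c].
    by apply/seteqP; split=> p /=; rewrite dE a00 mul0r add0r // => -[].
  rewrite product_measure2E//; last exact: mH.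
  rewrite IH ?mule0//.
  apply: contra_neq a0 => a'0; rewrite -[a](@hsubmxK _ _ 1 n) -/a' a'0.
  rewrite (_ : lsubmx _ = 0) ?row_mx0//.
  apply/rowP => i; rewrite !mxE (ord1 i) -[RHS]a00; congr (a _ _); exact/val_inj.
rewrite /product_measure2 /=; apply: integral0_eq => y _ /=.
have -> : ysection ((@rV_cons R n) @^-1` [set x | dotv a x = c]) y =
    [set (c - dotv a' y) / a ord0 ord0].
  apply/seteqP; split=> t; rewrite /ysection /= inE /= dE /= => h.
    by rewrite -h addrK mulrAC divff// mul1r.
  by rewrite h mulrCA divff// mulr1 subrK.
exact: lebesgue_measure_set1.
Qed.

Section bounded_integrable.
Context d (T : measurableType d) (R : realType) (mu : {measure set T -> \bar R}).
Variables (D : set T) (mD : measurable D) (fD : (mu D < +oo)%E).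

Lemma ae_bounded_integrable (f : T -> R) (M : R) : measurable_fun D f ->
  {ae mu, forall x, D x -> `|f x| <= M} -> mu.-integrable D (EFin \o f).
Proof.
move=> mf fM; apply/integrableP; split; first exact/measurable_EFinP.
apply: (@le_lt_trans _ _ (\int[mu]_(x in D) (cst `|M|%:E) x)%E).
  apply: ae_ge0_le_integral => //.
  - by apply: measurableT_comp => //; exact/measurable_EFinP.
  - by move=> x _; rewrite /= lee_fin.
  apply: filterS fM => x fM Dx; rewrite /= lee_fin (le_trans (fM Dx))//.
  exact: ler_norm.
by rewrite integral_cst// lte_mul_pinfty.
Qed.

Lemma Lp_on_measurable (f : T -> R) p : Lp_on mu p D f -> measurable_fun D f.
Proof.
rewrite /Lp_on => /sub_Lfun_mfun; rewrite inE /= => mf.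
exact/(measurable_restrictT _ mD).
Qed.

Lemma Lp_on_bounded (f : T -> R) : Lp_on mu +oo%E D f ->
  exists M, {ae mu, forall x, D x -> `|f x| <= M}.
Proof.
rewrite /Lp_on => /sub_Lfun_finLfun; rewrite inE /= /finite_norm unlock /Lnorm.
case: ifPn => [_ /ess_supr_bounded[M fM]|mu0 _].
  exists M; apply: filterS fM => x /= fM Dx; apply: le_trans fM.
  by rewrite patchE mem_set.
exists 0; exists setT; split => //; apply/eqP.
by rewrite eq_le measure_ge0 andbT leNgt.
Qed.

(** Domination by 1 + f^2, where the constant is integrable because [D] has finite measure. *)
Lemma Lp_on2_integrable (f : T -> R) : Lp_on mu 2%:E D f ->
  mu.-integrable D (EFin \o f).
Proof.
move=> f2; have mf := Lp_on_measurable f2.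
have /(integrableS measurableT mD (@subsetT _ _)) f2i := Lfun2_integrable_sqr f2.
have i1 : mu.-integrable D (EFin \o cst (1 : R)).
  apply: measurable_bounded_integrable => //.
  by exists 1; split=> // M M1 x _; rewrite /= normr1 ltW.
apply: le_integrable (integrableD mD i1 f2i) => //; first exact/measurable_EFinP.
move=> x Dx; rewrite /= lee_fin patchE mem_set//.
have := sqr_ge0 (`|f x| - 1); rewrite -[f x ^+ 2]real_normK ?num_real// => h.
rewrite (ger0_norm (_ : 0 <= 1 + `|f x| ^+ 2)) ?addr_ge0 ?sqr_ge0//.
have := sqr_ge0 (`|f x|); nra.
Qed.

Lemma integrable_Mbounded (f g : T -> R) (M : R) :
  mu.-integrable D (EFin \o f) -> measurable_fun D g ->
  {ae mu, forall x, D x -> `|g x| <= M} ->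
  mu.-integrable D (EFin \o (fun x => f x * g x)).
Proof.
move=> fi mg gM; have /integrableP[/measurable_EFinP mf fi1] := fi.
apply/integrableP; split; first exact/measurable_EFinP/measurable_funM.
apply: (@le_lt_trans _ _ (\int[mu]_(x in D) (`|M|%:E * `|(EFin \o f) x|))%E).
  apply: ae_ge0_le_integral => //.
  - apply: measurableT_comp => //; exact/measurable_EFinP/measurable_funM.
  - by apply: measurable_funeM; apply: measurableT_comp => //; exact/measurable_EFinP.
  - apply: filterS gM => x gM Dx; rewrite /= lee_fin normrM mulrC.
    by rewrite ler_wpM2r// (le_trans (gM Dx))// ler_norm.
rewrite ge0_integralZl//.
  by rewrite lte_mul_pinfty.
by apply: measurableT_comp => //; exact/measurable_EFinP.
Qed.

End bounded_integrable.

(** * Geometry of a discretization *)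

(** The rows of [B] together with [n] are d orthonormal vectors, as [d.-1 + 1 = d] for d > 0, so
    they span. The remainder [w] lies in their span and is orthogonal to all of them. *)
Lemma orthonormal_decomposition (R : realType) d (B : 'M[R]_(d.-1, d))
    (n : 'rV[R]_d) : (0 < d)%N ->
  B *m B^T = 1%:M -> B *m n^T = 0 -> dotv n n = 1 ->
  forall v : 'rV[R]_d, v = (v *m B^T) *m B + dotv v n *: n.
Proof.
move=> d0 BB Bn nn v; pose C : 'M[R]_(d.-1 + 1, d) := col_mx B n.
have nB : n *m B^T = 0 by rewrite -[LHS]trmxK trmx_mul trmxK Bn trmx0.
have nn1 : n *m n^T = 1%:M by apply/matrixP => i j; rewrite !ord1 [RHS]mxE -nn.
have CC : C *m C^T = 1%:M.
  by rewrite /C tr_col_mx mul_col_row BB Bn nB nn1 scalar_mx_block.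
have C_full : row_full C.
  rewrite /row_full eqn_leq rank_leq_col /=.
  have /(leq_trans _) := mxrankM_maxl C C^T; apply.
  by rewrite CC mxrank1 addn1 prednK.
apply/eqP; rewrite -subr_eq0; set w := _ - _.
have /submxP[x wx] : (w <= C)%MS by exact: submx_full.
have wC : w *m C^T = 0.
  rewrite /C tr_col_mx mul_mx_row -[RHS](@row_mx0 _ _ _ 1); congr row_mx.
    rewrite /w mulmxBl mulmxDl -scalemxAl nB scaler0 addr0.
    by rewrite -(mulmxA (v *m B^T) B B^T) BB mulmx1 subrr.
  rewrite /w mulmxBl mulmxDl -scalemxAl nn1.
  rewrite -(mulmxA (v *m B^T) B n^T) Bn mulmx0 add0r.
  apply/matrixP => i j; rewrite !ord1 !mxE /= mulr1 /dotv mxE.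
  by apply/eqP; rewrite subr_eq0.
by rewrite wx; move: wC; rewrite wx -mulmxA CC mulmx1 => ->; rewrite mul0mx.
Qed.

Section geometry.
Context (R : realType) (d : nat) (Omega : set 'rV[R]_d) (D : discretization Omega).
Hypothesis d_gt0 : (0 < d)%N.
Implicit Types (K L : cell D) (s : face D) (x y p : 'rV[R]_d).

Local Notation a := face_orig.
Local Notation B := face_frame.
Local Notation n := normal.
Local Notation c := Defs.center.

Lemma normal_dotv K s : s \in faces_of K -> dotv (n K s) (n K s) = 1.
Proof.
move=> sK; have := normal_unit sK; rewrite /enorm => /(congr1 (fun t => t ^+ 2)).
by rewrite sqr_sqrtr ?dotv_ge0// expr1n.
Qed.

Lemma hyperplaneP K s x : s \in faces_of K ->
  hyperplane s x <-> dotv (x - a s) (n K s) = 0.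
Proof.
move=> sK; have Bn := normal_orthogonal sK; split=> [[y _ <-]|xn].
  by rewrite /chart addrAC subrr add0r /dotv -mulmxA Bn mulmx0 mxE.
exists ((x - a s) *m (B s)^T) => //.
have := orthonormal_decomposition d_gt0 (face_frame_orthonormal s) Bn
  (normal_dotv sK) (x - a s).
by rewrite xn scale0r addr0 /chart => <-; rewrite addrC subrK.
Qed.

Lemma face_setP K s x : s \in faces_of K ->
  face_set s x <->
  dotv (x - a s) (n K s) = 0 /\ face_dom s ((x - a s) *m (B s)^T).
Proof.
move=> sK; have chartK : hyperplane s x ->
    chart (a s) (B s) ((x - a s) *m (B s)^T) = x.
  move=> [y _ <-]; rewrite /chart addrAC subrr add0r.
  by rewrite -!mulmxA (mulmxA (B s)) face_frame_orthonormal mul1mx.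
split=> [sx|[xn]].
  have hx := face_hyperplane sx; split; first by move/(hyperplaneP x sK): hx.
  by rewrite /face_dom /= chartK.
by rewrite /face_dom /= chartK//; exact/(hyperplaneP x sK).
Qed.

Lemma center_off_hyperplane K s : s \in faces_of K ->
  dotv (a s - c K) (n K s) != 0.
Proof.
move=> sK; apply/negP => /eqP ac0.
have := center_dist_gt0 sK; apply/negP; rewrite -leNgt.
have hc : hyperplane s (c K).
  by apply/(hyperplaneP (c K) sK); rewrite -opprB dotvNl ac0 oppr0.
apply: ge_inf.
  by exists 0 => _ [y _ <-]; exact: sqrtr_ge0.
by exists (c K) => //; rewrite /enorm subrr dotv0l sqrtr0.
Qed.

(* The ray from the center through p meets the hyperplane of s at the point
   center + (height p)^-1 *: (p - center), whose chart coordinate is proj p. *)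
Definition cone_height K s p : R :=
  dotv (p - c K) (n K s) / dotv (a s - c K) (n K s).

Definition cone_proj K s p : 'rV[R]_d.-1 :=
  (c K + (cone_height K s p)^-1 *: (p - c K) - a s) *m (B s)^T.

(** The parameter and the base point hidden in [open_cone] are recovered as explicit functions of
    [p], continuous where the height is positive; openness of the cone becomes openness of
    [face_dom] and of an interval. *)
Lemma cell_coneP K s p : s \in faces_of K ->
  cell_cone K s p <->
  0 < cone_height K s p < 1 /\ face_dom s (cone_proj K s p).
Proof.
move=> sK; have a0 := center_off_hyperplane sK.
rewrite /cone_proj /cell_cone /open_cone; split.
  move=> [t /= t01 [y sy <-]].
  have [yn ydom] := (face_setP y sK).1 sy.
  have -> : cone_height K s (c K + t *: (y - c K)) = t.
    rewrite /cone_height addrAC subrr add0r dotvZl.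
    have -> : y - c K = (y - a s) + (a s - c K) by rewrite addrA subrK.
    by rewrite dotvDl yn add0r mulfK.
  split=> //; have t0 : t != 0 by case/andP: t01 => /gt_eqF ->.
  have -> : c K + t *: (y - c K) - c K = t *: (y - c K).
    by rewrite addrAC subrr add0r.
  by rewrite scalerA mulVf// scale1r (addrC (c K)) subrK.
set t := cone_height K s p => -[t01 pdom].
have t0 : t != 0 by case/andP: t01 => /gt_eqF ->.
exists t => //; exists (c K + t^-1 *: (p - c K)); last first.
  by rewrite addrAC subrr add0r scalerA divff// scale1r addrC subrK.
apply/(face_setP _ sK); split=> //.
rewrite -addrA addrCA dotvDl dotvZl.
have -> : dotv (p - c K) (n K s) = t * dotv (a s - c K) (n K s).
  by rewrite /t /cone_height divfK.
by rewrite mulrA mulVf// mul1r -(opprB (a s) (c K)) dotvNl subrr.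
Qed.

Lemma near_cone_proj K s p : s \in faces_of K ->
  0 < cone_height K s p -> face_dom s (cone_proj K s p) ->
  \forall q \near p, 0 < cone_height K s q /\ face_dom s (cone_proj K s q).
Proof.
move=> sK hp pdom.
have ch : (fun q => cone_height K s q) @ p --> cone_height K s p.
  apply: contM; last exact: cont_cst.
  apply: continuous_dotv; last exact: cont_cst.
  by apply: contB; [exact: cont_id|exact: cont_cst].
have cp : (fun q => cone_proj K s q) @ p --> cone_proj K s p.
  apply: (@continuous_mulmx _ _ _ _
    (fun q => c K + (cone_height K s q)^-1 *: (q - c K) - a s)).
  apply: contB; last exact: cont_cst.
  apply: contD; first exact: cont_cst.
  apply: contZ.
    by apply: contV => //; rewrite gt_eqF.
  by apply: contB; [exact: cont_id|exact: cont_cst].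
apply: filterI.
  by apply: (cvgr_gt _ ch).
apply: cp; apply: open_nbhs_nbhs; split=> //; exact: face_open.
Qed.

Lemma cell_cone_open K s : s \in faces_of K -> open (cell_cone K s).
Proof.
move=> sK; rewrite openE => p /(cell_coneP p sK)[/andP[h0 h1] pdom].
have h : {for p, continuous (cone_height K s)}.
  apply: contM; last exact: cont_cst.
  apply: continuous_dotv; last exact: cont_cst.
  by apply: contB; [exact: cont_id|exact: cont_cst].
have h1' : \forall q \near p, cone_height K s q < 1 by apply: (cvgr_lt _ h).
apply: filterS2 (near_cone_proj sK h0 pdom) h1' => q [q0 qdom] q1.
by apply/(cell_coneP q sK); rewrite q0 q1.
Qed.

(** On the face the height equals 1, so every condition of [cell_coneP] is stable near [y] except
    height < 1. That remaining condition says on which side of the hyperplane [p] lies. *)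
Lemma face_cone_near K s y : s \in faces_of K -> face_set s y ->
  \forall p \near y, cone_height K s p < 1 -> cell_cone K s p.
Proof.
move=> sK sy; have a0 := center_off_hyperplane sK.
have [yn ydom] := (face_setP y sK).1 sy.
have h1 : cone_height K s y = 1.
  rewrite /cone_height.
  have -> : y - c K = (y - a s) + (a s - c K) by rewrite addrA subrK.
  by rewrite dotvDl yn add0r divff.
have : face_dom s (cone_proj K s y).
  by rewrite /cone_proj h1 invr1 scale1r addrCA subrr addr0.
move=> /(near_cone_proj sK); rewrite h1 => /(_ ltr01).
apply: filterS => p [p0 pdom] p1; apply/(cell_coneP p sK).
by rewrite p0 p1.
Qed.

Lemma faces_in_frontier K s : s \in faces_of K ->
  face_set s `<=` frontier (cell_set K).
Proof.
by move=> sK x sx; rewrite cell_frontier; exists s => //; exact: subset_closure.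
Qed.

Lemma frontier_notin K x : frontier (cell_set K) x -> ~ cell_set K x.
Proof. by move=> [_]; have /interior_id -> := @cell_open _ _ _ D K. Qed.

Lemma closure_face_hyperplane K s x : s \in faces_of K ->
  closure (face_set s) x -> dotv (x - a s) (n K s) = 0.
Proof.
move=> sK; pose H := [set y | dotv (y - a s) (n K s) = 0].
suff cH : closed H.
  move=> sx; have : closure H x.
    by apply: closure_subset sx => y /(face_setP y sK)[].
  by rewrite -(closure_id H).1.
rewrite (_ : H = (fun y => dotv (y - a s) (n K s)) @^-1` [set 0]) //.
apply: preimage_closed => [y _|]; last exact: closed_eq.
apply: continuous_dotv; last exact: cont_cst.
by apply: contB; [exact: cont_id|exact: cont_cst].
Qed.

(* Were the segment to leave K early, it would run inside the frontier, hence
   have two points in one face, whose hyperplane would contain the center. *)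
Lemma frontier_segment K y (t : R) : frontier (cell_set K) y -> 0 <= t < 1 ->
  cell_set K (c K + t *: (y - c K)).
Proof.
move=> Ky /andP[t0 t1]; apply: contrapT => Kt.
pose p r := c K + r *: (y - c K).
have tpos : 0 < t.
  rewrite lt_neqAle t0 andbT; apply/eqP => t0'; apply: Kt.
  by rewrite -t0' scale0r addr0; exact: center_in.
have pN (r : R) : t <= r -> ~ cell_set K (p r).
  move=> tr Kr; apply: Kt.
  have r0 : 0 < r by exact: lt_le_trans tr.
  have /(_ (t / r)) := center_star Kr.
  rewrite divr_ge0 ?(ltW r0)//= ler_pdivrMr// mul1r => /(_ tr).
  by rewrite /p addrAC subrr add0r scalerA divfK ?gt_eqF.
(* The homothety of ratio r about the center is continuous and maps the cell into itself by
   star-shapedness, so it maps the closure into the closure. *)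
have pc (r : R) : 0 <= r <= 1 -> closure (cell_set K) (p r).
  move=> r01 N; have cp : (fun z => c K + r *: (z - c K)) @ y --> p r.
    apply: contD; first exact: cont_cst.
    apply: contZ; first exact: cont_cst.
    by apply: contB; [exact: cont_id|exact: cont_cst].
  move=> /cp /= yN; have [z [Kz Nz]] := Ky.1 _ yN.
  exists (c K + r *: (z - c K)); split=> //; exact: center_star.
have fr (r : R) : t <= r < 1 -> exists s, s \in faces_of K /\ dotv (p r - a s) (n K s) = 0.
  move=> /andP[tr r1]; have : frontier (cell_set K) (p r).
    split; first by apply: pc; rewrite (le_trans t0 tr) ltW.
    by have /interior_id -> := @cell_open _ _ _ D K; exact: pN.
  rewrite cell_frontier => -[s /= sK sp]; exists s; split=> //.
  exact: closure_face_hyperplane sp.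
(* Pigeonhole: equally spaced parameters in [[t, 1)], one more than there are faces. *)
pose r (i : 'I_#|face D|.+1) := t + (1 - t) * (i%:R / #|face D|.+1%:R).
have r01 i : t <= r i < 1.
  have m0 : 0 < #|face D|.+1%:R :> R by [].
  have i0 : 0 <= (i%:R / #|face D|.+1%:R : R) by rewrite divr_ge0.
  have i1 : (i%:R / #|face D|.+1%:R : R) < 1 by rewrite ltr_pdivrMr// mul1r ltr_nat.
  have tq : 0 <= (1 - t) * (i%:R / #|face D|.+1%:R) by rewrite mulr_ge0// subr_ge0 ltW.
  have tq1 : (1 - t) * (i%:R / #|face D|.+1%:R) < 1 - t.
    by rewrite gtr_pMr// subr_gt0.
  rewrite /r; move: tq tq1; set z := (1 - t) * _ => tq tq1.
  by apply/andP; split; lra.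
have /choice[f fP] := fun i => fr (r i) (r01 i).
have : ~ injective f.
  by move=> /leq_card; rewrite card_ord ltnn.
apply=> i j fij; apply/eqP; apply: contrapT => /negP ij.
have [sK pi] := fP i; have [_] := fP j; rewrite -fij => pj.
have /eqP := center_off_hyperplane sK; apply.
have rij : r i - r j != 0.
  rewrite /r subr_eq0; apply: contra ij => /eqP/addrI/mulfI.
  rewrite subr_eq0 gt_eqF// => /(_ isT)/(congr1 (fun z : R => z * #|face D|.+1%:R)).
  by rewrite !divfK ?pnatr_eq0// => /eqP; rewrite eqr_nat.
have yc : dotv (y - c K) (n K (f i)) = 0.
  apply: (mulfI rij); rewrite mulr0 mulrBl -!dotvZl -dotvBl.
  have -> : r i *: (y - c K) - r j *: (y - c K) = (p (r i) - a (f i)) - (p (r j) - a (f i)).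
    by rewrite opprB addrA subrK /p opprD addrACA subrr add0r.
  by rewrite dotvBl pi pj subrr.
have pE : p (r i) - a (f i) = r i *: (y - c K) - (a (f i) - c K).
  by rewrite opprB /p (addrC (c K)) addrA.
move: pi; rewrite pE (dotvBl (_ *: _)) dotvZl yc mulr0 sub0r => /eqP.
by rewrite oppr_eq0 => /eqP.
Qed.

Lemma cell_cone_subset K s : s \in faces_of K -> cell_cone K s `<=` cell_set K.
Proof.
move=> sK _ [t /= /andP[t0 t1] [y sy <-]].
by apply: frontier_segment (faces_in_frontier sK sy) _; rewrite ltW.
Qed.

Lemma cvg_normal_right y (v : 'rV[R]_d) : (fun t : R => y + t *: v) @ 0^'+ --> y.
Proof.
apply: cvg_at_right_filter; rewrite -[X in _ --> X]addr0 -[X in _ + X](scale0r v).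
apply: contD; first exact: cont_cst.
by apply: (@contZ R _ 0 _ id (fun=> v)); [exact: cont_id|exact: cont_cst].
Qed.

(** If the normal pointed towards the center, a small step along it from a face point would have
    height below 1, hence enter the cone and the cell, against [normal_outward]. *)
Lemma center_side K s : s \in faces_of K -> 0 < dotv (a s - c K) (n K s).
Proof.
move=> sK; rewrite lt_neqAle eq_sym center_off_hyperplane//= leNgt.
apply/negP => ac; have [y sy] := face_nonempty s.
have [yn ydom] := (face_setP y sK).1 sy.
have nc : \forall t \near 0^'+, cone_height K s (y + t *: n K s) < 1 ->
    cell_cone K s (y + t *: n K s).
  exact: cvg_normal_right (n K s) _ (face_cone_near sK sy).
have out := normal_outward sK sy.
have [t [[tc [_ tout]] t0]] := filter_ex (filterI (filterI nc out) (nbhs_right_gt (0 : R))).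
apply: tout; apply: (cell_cone_subset sK); apply: tc.
rewrite /cone_height.
have -> : y + t *: n K s - c K = (y - a s) + (a s - c K) + t *: n K s.
  by rewrite addrA subrK addrAC.
rewrite dotvDl (dotvDl (y - _)) yn add0r dotvZl normal_dotv// mulr1 mulrDl divff ?lt_eqF//.
by rewrite gtrDl pmulr_rlt0// invr_lt0.
Qed.

Lemma cone_heightE K s p : s \in faces_of K ->
  cone_height K s p = 1 + dotv (p - a s) (n K s) / dotv (a s - c K) (n K s).
Proof.
move=> sK; rewrite /cone_height.
have -> : p - c K = (p - a s) + (a s - c K) by rewrite addrA subrK.
by rewrite dotvDl mulrDl divff ?gt_eqF ?center_side// addrC.
Qed.

Section interior_face.
Variables (K L : cell D) (s : face D).
Hypotheses (KL : K != L) (sK : s \in faces_of K) (sL : s \in faces_of L).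

Lemma cells_disjoint x : cell_set K x -> cell_set L x -> False.
Proof.
move=> Kx Lx; have /trivIsetP/(_ K L I I KL) := @cell_disjoint _ _ _ D.
by rewrite -subset0 => /(_ x); exact.
Qed.

(** Both are unit vectors orthogonal to the same frame, so they agree up to sign; equal signs would
    put [y - t *: n K s] in both cells for small t. *)
Lemma normal_opposite : n L s = - n K s.
Proof.
have := orthonormal_decomposition d_gt0 (face_frame_orthonormal s)
  (normal_orthogonal sK) (normal_dotv sK) (n L s).
have -> : n L s *m (face_frame s)^T = 0.
  by rewrite -[LHS]trmxK trmx_mul trmxK (normal_orthogonal sL) trmx0.
rewrite mul0mx add0r ; set r := dotv _ _ => nL.
have : r ^+ 2 = 1.
  by have := normal_dotv sL; rewrite nL dotvZl dotvZr normal_dotv// mulr1 expr2.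
move=> /eqP; rewrite sqrf_eq1 => /orP[/eqP r1|/eqP r1]; last first.
  by rewrite nL r1 scaleN1r.
have [y sy] := face_nonempty s.
have oK := normal_outward sK sy; have oL := normal_outward sL sy.
have [t [[Kt _] [Lt _]]] := filter_ex (filterI oK oL).
case: (cells_disjoint Kt); move: Lt; rewrite nL r1 scale1r; exact.
Qed.

(** Close to a face point the sign of [dotv (p - a s) (n K s)] decides: negative puts [p] in the
    cone of [K], positive in that of [L] as the normals are opposite, and zero in the face, which is
    relatively open. *)
Lemma interior_face_nbhd : open (cell_set K `|` face_set s `|` cell_set L).
Proof.
rewrite openE => x [[Kx|sx]|Lx].
- have : nbhs x (cell_set K) by apply: open_nbhs_nbhs; split=> //; exact: cell_open.
  by apply: filterS => y Ky; left; left.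
- have [xn xdom] := (face_setP x sK).1 sx.
  have cB : (fun p => (p - a s) *m (B s)^T) @ x --> (x - a s) *m (B s)^T.
    apply: continuous_mulmx.
    by apply: contB; [exact: cont_id|exact: cont_cst].
  have ndom : \forall p \near x, face_dom s ((p - a s) *m (B s)^T).
    by apply: cB; apply: open_nbhs_nbhs; split=> //; exact: face_open.
  apply: filterS3 (face_cone_near sK sx) (face_cone_near sL sx) ndom.
  move=> p; rewrite !cone_heightE// normal_opposite dotvNr => pK pL pdom.
  have aK := center_side sK.
  have aL : 0 < dotv (a s - c L) (- n K s) by rewrite -normal_opposite center_side.
  have [p0|p0|p0] := ltgtP (dotv (p - a s) (n K s)) 0.
  + left; left; apply: (cell_cone_subset sK); apply: pK.
    by rewrite gtrDl pmulr_llt0// invr_gt0.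
  + right; apply: (cell_cone_subset sL); apply: pL.
    by rewrite gtrDl pmulr_llt0 ?invr_gt0// oppr_lt0.
  + by left; right; apply/(face_setP p sK).
- have : nbhs x (cell_set L) by apply: open_nbhs_nbhs; split=> //; exact: cell_open.
  by apply: filterS => y Ly; right.
Qed.

(** [Omega] is the interior of the closed set [P'], which contains [closure Omega] and therefore the
    face. The union is open and included in [P'], hence in its interior. *)
Lemma interior_face_nbhd_subset : polyhedral Omega ->
  cell_set K `|` face_set s `|` cell_set L `<=` Omega.
Proof.
move=> [P OP].
pose P' := [set x | has (all (fun h : 'rV[R]_d * R => dotv h.1 x <= h.2)) P].
have chalf (h : 'rV[R]_d * R) : closed [set x | dotv h.1 x <= h.2].
  rewrite (_ : mkset _ = dotv h.1 @^-1` [set r | r <= h.2]) //.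
  apply: preimage_closed => [y _|]; last exact: closed_le.
  by apply: continuous_dotv; [exact: cont_cst|exact: cont_id].
have call (l : seq ('rV[R]_d * R)) :
    closed [set x | all (fun h => dotv h.1 x <= h.2) l].
  elim: l => [|h l IH].
    have -> : [set x : 'rV[R]_d | all (fun h : 'rV[R]_d * R => dotv h.1 x <= h.2) [::]] = setT.
      by apply/seteqP; split.
    exact: closedT.
  rewrite (_ : mkset _ = [set x | dotv h.1 x <= h.2] `&`
    [set x | all (fun h => dotv h.1 x <= h.2) l]); first exact: closedI.
  by apply/seteqP; split=> x /= /andP.
have cP : closed P'.
  rewrite /P'; elim: (P) => [|l Q IH].
    rewrite (_ : mkset _ = set0); first exact: closed0.
    by apply/seteqP; split.
  rewrite (_ : mkset _ = [set x | all (fun h => dotv h.1 x <= h.2) l] `|`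
    [set x | has (all (fun h : 'rV[R]_d * R => dotv h.1 x <= h.2)) Q]).
    exact: closedU.
  by apply/seteqP; split=> x /= /orP.
have OP' : Omega `<=` P' by rewrite OP; exact: interior_subset.
have cO : closure Omega `<=` P'.
  by rewrite (closure_id P').1//; exact: closure_subset.
rewrite [X in _ `<=` X]OP -open_subsetE; last exact: interior_face_nbhd.
move=> x [[Kx|sx]|Lx]; [apply: OP'; exact: cell_subset Kx| |
  apply: OP'; exact: cell_subset Lx].
by apply: cO; exact: face_subset sx.
Qed.

End interior_face.

End geometry.

(** * Cut-off functions of class C1 *)

Section C1_functions.
Context (R : realType) (n : nat).
Implicit Types (f g : 'rV[R]_n -> R).

Lemma C1_intro f (df : 'I_n -> 'rV[R]_n -> R) :
  (forall x, differentiable f x) ->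
  (forall i x, 'D_(delta_mx ord0 i) f x = df i x) ->
  (forall i, continuous (df i)) -> C1 f.
Proof.
move=> dif fE cdf; split=> // x.
apply: (@cvg_rV _ _ _ (grad f)) => i; rewrite mxE fE.
rewrite (_ : (fun t => _) = df i); first exact: cdf.
by apply/funext => t; rewrite mxE fE.
Qed.

Lemma C1_continuous f : C1 f -> continuous f.
Proof. by move=> [df _] x; exact: differentiable_continuous. Qed.

Lemma C1_partial f i : C1 f -> continuous (fun x => 'D_(delta_mx ord0 i) f x).
Proof.
move=> [_ cf].
have -> : (fun x => 'D_(delta_mx ord0 i) f x) = (fun x => grad f x ord0 i).
  by apply/funext => x; rewrite mxE.
move=> x; exact: (continuous_cvg _ (@coord_continuous R 1 n ord0 i _) (cf x)).
Qed.

Lemma C1_cst (a : R) : C1 (fun _ : 'rV[R]_n => a).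
Proof.
apply: (@C1_intro _ (fun _ _ => 0)) => [x|i x|i x].
- exact: differentiable_cst.
- exact: derive_cst.
- exact: cont_cst.
Qed.

Lemma C1_coord i : C1 (fun x : 'rV[R]_n => x ord0 i).
Proof.
apply: (@C1_intro _ (fun j _ => (i == j)%:R)) => [x|j x|j x].
- exact: differentiable_coord.
- rewrite deriveE; last exact: differentiable_coord.
  have lin : linear (fun N : 'rV[R]_n => N ord0 i : R) by move=> a u v; rewrite !mxE.
  pose L : {linear 'rV[R]_n -> R} := HB.pack (fun N : 'rV[R]_n => N ord0 i : R)
    (GRing.isLinear.Build _ _ _ _ _ lin).
  have -> : (fun N : 'rV[R]_n => N ord0 i) = L by [].
  rewrite diff_lin; first by rewrite /= mxE eqxx eq_sym.
  exact: coord_continuous.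
- exact: cont_cst.
Qed.

Lemma C1_add f g : C1 f -> C1 g -> C1 (fun x => f x + g x).
Proof.
move=> [df cf] [dg cg].
apply: (@C1_intro _ (fun i x => 'D_(delta_mx ord0 i) f x + 'D_(delta_mx ord0 i) g x))
  => [x|i x|i x].
- exact: differentiableD.
- by rewrite deriveD//; exact: diff_derivable.
- by apply: contD; apply: C1_partial.
Qed.

Lemma C1_mul f g : C1 f -> C1 g -> C1 (fun x => f x * g x).
Proof.
move=> Cf Cg; have [df cf] := Cf; have [dg cg] := Cg.
apply: (@C1_intro _ (fun i x => f x * 'D_(delta_mx ord0 i) g x
    + g x * 'D_(delta_mx ord0 i) f x)) => [x|i x|i x].
- exact: differentiableM.
- by rewrite deriveM//; exact: diff_derivable.
- by apply: contD; apply: contM; (exact: C1_continuous || exact: C1_partial).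
Qed.

Lemma C1_comp (h : R -> R) f : (forall y, derivable h y 1) ->
  continuous (derive1 h) -> C1 f -> C1 (fun x => h (f x)).
Proof.
move=> dh ch Cf; have [df cf] := Cf.
have dh' y : differentiable h y by exact/derivable1_diffP.
apply: (@C1_intro _ (fun i x => 'D_(delta_mx ord0 i) f x * derive1 h (f x)))
  => [x|i x|i x].
- exact: differentiable_comp.
- rewrite deriveE; last exact: differentiable_comp.
  by rewrite diff_comp// diff1E//= deriveE.
- apply: contM; first exact: C1_partial.
  exact: (continuous_cvg _ (ch _) (@C1_continuous _ Cf x)).
Qed.

Lemma C1_sum (I : Type) (r : seq I) (F : I -> 'rV[R]_n -> R) :
  (forall i, C1 (F i)) -> C1 (fun x => \sum_(i <- r) F i x).
Proof.
move=> CF; elim: r => [|i r IH].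
  by under eq_fun do rewrite big_nil; exact: C1_cst.
by under eq_fun do rewrite big_cons; exact: C1_add.
Qed.

Lemma C1c_in_bounded (U : set 'rV[R]_n) f : C1c_in U f ->
  exists M, forall x, `|f x| <= M /\ forall i, `|grad f x ord0 i| <= M.
Proof.
move=> [Cf [C [cC CU f0]]].
have oC : open (~` C) by apply: closed_openC; exact: compact_closed.
have bnd (h : 'rV[R]_n -> R) : continuous h -> (forall x, ~ C x -> h x = 0) ->
    exists2 M, 0 <= M & forall x, `|h x| <= M.
  move=> ch h0; have : bounded_set (h @` C).
    by apply: compact_bounded; apply: continuous_compact => //; exact: continuous_subspaceT.
  move=> [M [_ /(_ (`|M| + 1))]] hM; exists (`|M| + 1); first by rewrite addr_ge0.
  move=> x; have [Cx|nCx] := pselect (C x); last by rewrite h0// normr0 addr_ge0.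
  by apply: hM; [rewrite (le_lt_trans (ler_norm _))// ltrDl|exists x].
have [M0 M00 fM] := bnd _ (C1_continuous Cf) f0.
have /choice[M MP] i : exists M, 0 <= M /\ forall x, `|grad f x ord0 i| <= M.
  have [|x nCx|M M_ge0 MP] := bnd (fun x => grad f x ord0 i).
  - rewrite (_ : (fun x => _) = (fun x => 'D_(delta_mx ord0 i) f x)).
      exact: C1_partial.
    by apply/funext => x; rewrite mxE.
  - rewrite mxE (@near_eq_derive _ _ _ _ (cst 0)) ?derive_cst//.
    have : nbhs x (~` C) by exact: open_nbhs_nbhs.
    by apply: filterS => y; exact: f0.
  - by exists M.
exists (M0 + \sum_i M i) => x; split=> [|i].
  by rewrite (le_trans (fM x))// lerDl sumr_ge0// => i _; case: (MP i).
have [Mi0 MiP] := MP i; rewrite (le_trans (MiP x))// (bigD1 i)//=.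
rewrite addrCA lerDl addr_ge0// sumr_ge0// => j _; by case: (MP j).
Qed.

Lemma C1c_in_grad0 (U : set 'rV[R]_n) f x : C1c_in U f -> ~ U x -> grad f x = 0.
Proof.
move=> [Cf [C [cC CU f0]]] nUx.
have oC : open (~` C) by apply: closed_openC; exact: compact_closed.
apply/rowP => i; rewrite !mxE (@near_eq_derive _ _ _ _ (cst 0)) ?derive_cst//.
have : nbhs x (~` C) by apply: open_nbhs_nbhs; split=> // /CU.
by apply: filterS => y; exact: f0.
Qed.

Lemma C1c_in0 (U : set 'rV[R]_n) f x : C1c_in U f -> ~ U x -> f x = 0.
Proof. by move=> [Cf [C [cC CU f0]]] nUx; apply: f0 => /CU. Qed.

End C1_functions.

Section bumps.
Context (R : realType).

(** Positive exactly for y > 0; the square makes the derivative continuous at 0. *)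
Definition pos_sqr (y : R) : R := Num.max 0 y ^+ 2.

Lemma is_derive_pos_sqr (y : R) : is_derive y 1 pos_sqr (2 * Num.max 0 y).
Proof.
have sq (z : R) : is_derive z 1 (fun t : R => t ^+ 2) (2 * z).
  have -> : (fun t : R => t ^+ 2) = (id : R -> R) ^+ 2.
    by apply/funext => t; rewrite exprfctE.
  apply: is_derive_eq (@is_deriveX R R id 2 z 1 1 (is_derive_id z 1)) _.
  by rewrite /= expr1 /GRing.scale /= mulr1.
have [y0|y0|<-] := ltgtP 0 y.
- apply: near_eq_is_derive (sq y).
  have : \forall z \near y, 0 < z by exact: lt_nbhsr.
  by apply: filterS => z z0; rewrite /pos_sqr max_r// ltW.
- rewrite mulr0; apply: near_eq_is_derive (is_derive_cst (0 : R) y (1 : R)).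
  have : \forall z \near y, z < 0 by exact: lt_nbhsl.
  by apply: filterS => z z0; rewrite /pos_sqr max_l ?expr0n// ltW.
- have L : h^-1 *: ((pos_sqr \o shift 0) (h *: (1 : R)) - pos_sqr 0) @[h --> 0^'] --> (0 : R).
    apply/cvgrPdist_le => e e0.
    have : \forall h \near 0^', `|h : R| <= e by exact: dnbhs0_le.
    apply: filterS => h; apply: le_trans.
    rewrite /pos_sqr /= maxxx expr0n /= subr0 sub0r normrN /GRing.scale /= mulr1 addr0.
    have [h0|h0] := leP h 0.
      by rewrite expr0n /= mulr0 normr0.
    by rewrite expr2 mulKf// gt_eqF.
  by rewrite mulr0; apply: DeriveDef; [apply/cvg_ex; exists 0|exact: cvg_lim].
Qed.

Lemma pos_sqr_ge0 y : 0 <= pos_sqr y.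
Proof. exact: sqr_ge0. Qed.

Lemma C1_pos_sqr n (f : 'rV[R]_n -> R) : C1 f -> C1 (fun x => pos_sqr (f x)).
Proof.
apply: C1_comp => [y|]; first by case: (is_derive_pos_sqr y).
have -> : derive1 pos_sqr = (fun y => y + `|y|).
  apply/funext => y; rewrite derive1E; case: (is_derive_pos_sqr y) => _ ->.
  by rewrite maxr_absE add0r sub0r normrN mulrC divfK.
by move=> y; apply: contD; [exact: cont_id|exact: norm_continuous].
Qed.

(** This is y^2 / (1 + y^2): a smooth map into [0, 1) that fixes 0 and tends to 1 at infinity,
    turning a divergent sum of bumps into a cut-off. *)
Definition saturate (y : R) : R := 1 - (1 + y ^+ 2)^-1.

Lemma one_sqr_gt0 (y : R) : 0 < 1 + y ^+ 2.
Proof. by rewrite ltr_pwDl// sqr_ge0. Qed.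

Lemma saturate_bounds y : 0 <= saturate y <= 1.
Proof.
have y0 := one_sqr_gt0 y; rewrite /saturate subr_ge0 gerBl invr_ge0 (ltW y0) andbT.
by rewrite invf_le1// lerDl sqr_ge0.
Qed.

Lemma C1_saturate n (f : 'rV[R]_n -> R) : C1 f -> C1 (fun x => saturate (f x)).
Proof.
have der (y : R) : is_derive y 1 saturate ((1 + y ^+ 2) ^- 2 * (2 * y)).
  have sq : is_derive y 1 (fun t : R => 1 + t ^+ 2) (2 * y).
    have -> : (fun t : R => 1 + t ^+ 2) = cst 1 + (id : R -> R) ^+ 2.
      by apply/funext => t; rewrite fctE exprfctE.
    apply: is_derive_eq (is_deriveD (is_derive_cst (1 : R) y (1 : R))
      (@is_deriveX R R id 2 y 1 1 (is_derive_id y 1))) _.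
    by rewrite /= expr1 /GRing.scale /= mulr1 add0r.
  have y0 : 1 + y ^+ 2 != 0 by rewrite gt_eqF// one_sqr_gt0.
  have sv := @is_deriveV _ (fun t : R => 1 + t ^+ 2) y _ _ y0 sq.
  have -> : saturate = cst 1 - (fun t : R => (1 + t ^+ 2)^-1) by apply/funext.
  apply: is_derive_eq (is_deriveB (is_derive_cst (1 : R) y (1 : R)) sv) _.
  by rewrite /GRing.scale /= sub0r mulNr opprK.
apply: C1_comp => [y|]; first by case: (der y).
have -> : derive1 saturate = (fun y => (1 + y ^+ 2) ^- 2 * (2 * y)).
  by apply/funext => y; rewrite derive1E; case: (der y) => _ ->.
move=> y; apply: contM; last first.
  by apply: contM; [exact: cont_cst|exact: cont_id].
apply: contV; first by rewrite expf_neq0// gt_eqF// one_sqr_gt0.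
have c1 : (fun t : R => 1 + t ^+ 2) @ y --> 1 + y ^+ 2.
  apply: contD; first exact: cont_cst.
  by apply: contM; exact: cont_id.
exact: (contM c1 c1).
Qed.

Context (n : nat).
Implicit Types (U : set 'rV[R]_n) (p : 'rV[rat]_n * rat).

Definition ball_in U p := forall y : 'rV[R]_n, sqdist_to p.1 y <= ratr p.2 -> U y.

Definition ball_bump U p (x : 'rV[R]_n) : R :=
  if pselect (ball_in U p) then pos_sqr (ratr p.2 - sqdist_to p.1 x) else 0.

(* An open set U is the union of the countably many rational balls whose closed
   versions lie in U; the factor k.+1 makes the sum diverge on U. *)
Definition cutoff U k (x : 'rV[R]_n) : R :=
  saturate (\sum_(i < k) k.+1%:R *
    oapp (fun p => ball_bump U p x) 0 (unpickle i)).

Lemma C1_sqdist_to (a : 'rV[rat]_n) : C1 (@sqdist_to R n a).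
Proof.
rewrite (_ : sqdist_to a = fun x => \sum_i
  (x ord0 i + - map_mx ratr a ord0 i) * (x ord0 i + - map_mx ratr a ord0 i)).
  by apply: C1_sum => i; apply: C1_mul; apply: C1_add; (exact: C1_coord || exact: C1_cst).
by apply/funext => x; rewrite /sqdist_to dotvE; apply: eq_bigr => i _; rewrite !mxE.
Qed.

Lemma closed_ball_compact (a : 'rV[rat]_n) (r : R) :
  compact [set x : 'rV[R]_n | sqdist_to a x <= r].
Proof.
apply: bounded_closed_compact.
  exists (`|map_mx ratr a : 'rV[R]_n| + (`|r| + 1)); split; first exact: num_real.
  move=> M /ltW aM x /= xr; apply: le_trans aM.
  have := ler_normD (map_mx ratr a) (x - map_mx ratr a : 'rV[R]_n).
  rewrite addrC subrK => /le_trans; apply; rewrite lerD2l.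
  rewrite [leLHS]mx_normrE; apply: bigmax_le => [|[i j] _ /=]; first by rewrite addr_ge0.
  have := le_trans (sqr_coord_le_dotv (x - map_mx ratr a) j) xr.
  have -> : i = ord0 by exact: ord1.
  set z : R := (x - map_mx ratr a) ord0 j; rewrite -real_normK ?num_real//.
  have := ler_norm r; have := sqr_ge0 (`|z| - 1); have := normr_ge0 z; nra.
rewrite (_ : mkset _ = (fun x : 'rV[R]_n => sqdist_to a x) @^-1` [set t | t <= r])//.
apply: preimage_closed => [y _|]; last exact: closed_le.
exact: C1_continuous (C1_sqdist_to a) y.
Qed.

Lemma cutoff_C1c U k : C1c_in U (cutoff U k).
Proof.
split.
  apply: C1_saturate; apply: C1_sum => i; apply: C1_mul; first exact: C1_cst.
  case: (unpickle i) => [p|] /=; last exact: C1_cst.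
  rewrite /ball_bump; case: pselect => h /=; last exact: C1_cst.
  apply: C1_pos_sqr.
  rewrite (_ : (fun x => _) = fun x => ratr p.2 + (-1) * sqdist_to p.1 x).
    by apply: C1_add; [exact: C1_cst|apply: C1_mul; [exact: C1_cst|exact: C1_sqdist_to]].
  by apply/funext => x; rewrite mulN1r.
(* The i-th closed ball of the enumeration, empty for codes that decode to nothing or to a ball
   leaving [U]. The finite union of the first k of them supports [cutoff U k]. *)
pose E (i : nat) : set 'rV[R]_n := if unpickle i is Some p then
  if pselect (ball_in U p) then [set x | sqdist_to p.1 x <= ratr p.2] else set0
  else set0.
exists (\big[setU/set0]_(i < k) E i); split.
- apply: bigsetU_compact => i _; rewrite /E.
  case: (unpickle _) => [p|]; last exact: compact0.
  by case: pselect => h /=; [exact: closed_ball_compact|exact: compact0].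
- rewrite -bigcup_mkord => x [i _]; rewrite /E.
  by case: (unpickle _) => // p; case: pselect => //= h; exact: h.
- rewrite -bigcup_mkord => x xE; rewrite /cutoff big1 /saturate ?expr0n ?addr0 ?invr1 ?subrr//.
  move=> i _; case E1 : (unpickle i) => [p|] /=; last by rewrite mulr0.
  rewrite /ball_bump; case: pselect => h /=; last by rewrite mulr0.
  rewrite /pos_sqr max_l ?expr0n ?mulr0// subr_le0 leNgt; apply/negP => xp.
  apply: xE; exists i => //=; rewrite /E E1; case: pselect => //= _.
  exact: ltW.
Qed.

(** Once the code of a ball around [x] is below k, its bump alone makes the sum S at least
    [k.+1%:R * b]. Since 1 + S^2 >= S, the gap to 1 is at most 1 / ((k + 1) b). *)
Lemma cutoff_cvg U x : open U -> U x -> cutoff U ^~ x @ \oo --> (1 : R).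
Proof.
move=> oU Ux; have [a [r [xr rU]]] := rational_ball oU Ux.
pose b : R := pos_sqr (ratr r - sqdist_to a x).
have b0 : 0 < b by rewrite /b /pos_sqr exprn_gt0// lt_max subr_gt0 xr orbT.
have key k : (pickle (a, r) < k)%N -> 1 - b^-1 * harmonic k <= cutoff U k x <= 1.
  move=> kp; rewrite /cutoff; set S := \sum_(i < k) _.
  have /andP[_ ->] := saturate_bounds S; rewrite andbT lerD2l lerN2.
  have S0 : k.+1%:R * b <= S.
    rewrite /S (bigD1 (Ordinal kp)) //= pickleK /= /ball_bump.
    case: pselect => /= [_|]; last by case.
    rewrite lerDl sumr_ge0// => i _; rewrite mulr_ge0//.
    case: (unpickle _) => //= p; case: pselect => //= _; exact: pos_sqr_ge0.
  have kb : 0 < k.+1%:R * b by rewrite mulr_gt0.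
  have bk : 0 < b * k.+1%:R by rewrite mulrC.
  rewrite /harmonic /= -invfM lef_pV2 ?posrE ?one_sqr_gt0//.
  by rewrite mulrC; have := sqr_ge0 (S - 1); nra.
apply: (@squeeze_cvgr _ _ _ _ (fun k => 1 - b^-1 * harmonic k) (fun=> 1)).
- by near=> k; apply: key; near: k; exact: nbhs_infty_gt.
- rewrite -[X in _ --> X]subr0 -[X in _ - X](mulr0 b^-1).
  apply: cvgB; first exact: cvg_cst.
  by apply: cvgM; [exact: cvg_cst|exact: cvg_harmonic].
- exact: cvg_cst.
Unshelve. all: by end_near. Qed.

End bumps.

(** * Fluxes *)

Section integral_lemmas.
Context dd (T : measurableType dd) (R : realType) (mu : {measure set T -> \bar R}).

Lemma Rintegral_eq0 (A : set T) (f : T -> R) :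
  (forall x, A x -> f x = 0) -> \int[mu]_(x in A) f x = 0.
Proof.
move=> f0; rewrite (@eq_Rintegral _ _ _ mu A (cst 0)) => [|x]; last first.
  by rewrite inE => /f0.
by rewrite /Rintegral integral0.
Qed.

Lemma Rintegral_null_set (A : set T) (f : T -> R) : measurable A ->
  measurable_fun A f -> mu A = 0%E -> \int[mu]_(x in A) f x = 0.
Proof.
move=> mA mf A0; rewrite /Rintegral null_set_integral//.
exact/measurable_EFinP.
Qed.

Lemma Rintegral_ae_ge0 (A : set T) (f : T -> R) : measurable A ->
  measurable_fun A f -> {ae mu, forall x, A x -> 0 <= f x} ->
  0 <= \int[mu]_(x in A) f x.
Proof.
move=> mA mf f0.
have -> : \int[mu]_(x in A) f x = \int[mu]_(x in A) `|f x|.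
  rewrite /Rintegral; congr fine; apply: ae_eq_integral => //.
  - exact/measurable_EFinP.
  - by apply/measurable_EFinP; apply: measurableT_comp.
  - by apply: filterS f0 => x fx Ax; rewrite /= ger0_norm// fx.
by apply: Rintegral_ge0 => x _.
Qed.

Lemma Rintegral_cutoff_cvg (A : set T) (h : T -> R) (phi : nat -> T -> R) :
  measurable A -> mu.-integrable A (EFin \o h) ->
  (forall k, measurable_fun A (phi k)) ->
  (forall k x, A x -> 0 <= phi k x <= 1) ->
  (forall x, A x -> phi ^~ x @ \oo --> (1 : R)) ->
  (fun k => \int[mu]_(x in A) (phi k x * h x)) @ \oo --> \int[mu]_(x in A) h x.
Proof.
move=> mA hi mphi phi01 phi1.
have /integrableP[/measurable_EFinP mh _] := hi.
have [|||||_ _ cv] := @dominated_convergence _ _ _ mu A mA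
    (fun k x => (phi k x * h x)%:E) (EFin \o h) (abse \o (EFin \o h)).
- by move=> k; apply/measurable_EFinP; exact: measurable_funM.
- exact/measurable_EFinP.
- apply: aeW => x Ax; apply/fine_cvgP; split; first by near=> k.
  rewrite (_ : fine \o _ = fun k => phi k x * h x)// -[X in _ --> X]mul1r.
  by apply: cvgM; [exact: phi1|exact: cvg_cst].
- exact: integrable_abse.
- apply: aeW => x k Ax; rewrite /= lee_fin normrM.
  have /andP[p0 p1] := phi01 k x Ax.
  by rewrite -[leRHS]mul1r ler_wpM2r// ger0_norm.
rewrite /Rintegral; apply: fine_cvg; rewrite fineK//.
exact: integrable_fin_num.
Unshelve. all: by end_near. Qed.

End integral_lemmas.

Section discretization_measure.
Context (R : realType) (d : nat) (Omega : set 'rV[R]_d) (D : discretization Omega).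
Hypothesis d_gt0 : (0 < d)%N.
Hypothesis dom : domain Omega.
Implicit Types (K L : cell D) (s : face D).
Local Notation leb := (lebesgue_rV R d).
Local Notation leb1 := (lebesgue_rV R d.-1).

Lemma domain_measurable : measurable Omega.
Proof. by case: dom => _ oO _ _; exact: open_measurable_rV. Qed.

Lemma domain_finite : (leb Omega < +oo)%E.
Proof.
by case: dom => bO _ _ _; apply: bounded_finite_measure => //; exact: domain_measurable.
Qed.

Lemma cell_measurable K : measurable (cell_set K).
Proof. by apply: open_measurable_rV; exact: cell_open. Qed.

Lemma face_dom_measurable s : measurable (face_dom s).
Proof. by apply: open_measurable_rV; exact: face_open. Qed.

(** The chart is an isometry, so the face domain inherits boundedness from [Omega]. The factor
    [d%:R] in [N] passes from the sup norm to the Euclidean one, and [N + 1] bounds |z| when z^2 <=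
    N. *)
Lemma face_dom_finite s : (leb1 (face_dom s) < +oo)%E.
Proof.
apply: bounded_finite_measure; last exact: face_dom_measurable.
have [[M [_ /(_ (M + 1))]]] := dom; rewrite ltrDl ltr01 => /(_ isT) OM _ _ _.
have cM : closed [set x : 'rV[R]_d | `|x| <= M + 1].
  rewrite (_ : mkset _ = Num.norm @^-1` [set t | t <= M + 1])//.
  by apply: preimage_closed => [x _|]; [exact: norm_continuous|exact: closed_le].
have coM : closure Omega `<=` [set x : 'rV[R]_d | `|x| <= M + 1].
  by rewrite [X in _ `<=` X](closure_id _).1//; exact: closure_subset.
set a := face_orig s; pose N := d%:R * (M + 1 + `|a|) ^+ 2.
exists (N + 1); split; first exact: num_real.
move=> N' /ltW NN' y sy; apply: le_trans NN'.
have yM : `|chart a (face_frame s) y| <= M + 1.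
  by apply: coM; exact: face_subset sy.
have yB : `|y *m face_frame s| <= M + 1 + `|a|.
  have -> : y *m face_frame s = chart a (face_frame s) y - a.
    by rewrite /chart addrAC subrr add0r.
  by rewrite (le_trans (ler_normB _ _))// lerD2r.
have yy : dotv y y <= N.
  have -> : dotv y y = dotv (y *m face_frame s) (y *m face_frame s).
    rewrite [RHS]/dotv trmx_mul mulmxA -(mulmxA y) face_frame_orthonormal.
    by rewrite mulmx1.
  rewrite dotvE; apply: le_trans (_ : \sum_(i < d) (M + 1 + `|a|) ^+ 2 <= _); last first.
    by rewrite sumr_const card_ord -mulr_natl.
  apply: ler_sum => i _; rewrite -expr2 -real_normK ?num_real// ler_sqr ?nnegrE//.
    apply: le_trans yB; rewrite [leRHS]mx_normrE.
    exact: (le_bigmax _ (fun ij => `|(y *m face_frame s) ij.1 ij.2|) (ord0, i)).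
  exact: le_trans yB.
have N0 : 0 <= N by exact: le_trans (dotv_ge0 _) yy.
rewrite [leLHS]mx_normrE; apply: bigmax_le => [|[i j] _ /=]; first by rewrite addr_ge0.
have -> : i = ord0 by exact: ord1.
have := le_trans (sqr_coord_le_dotv y j) yy.
set z : R := y ord0 j; rewrite -real_normK ?num_real//.
have := sqr_ge0 (`|z| - 1); have := normr_ge0 z; nra.
Qed.

End discretization_measure.

Section flux.
Context (R : realType) (d : nat) (Omega : set 'rV[R]_d) (D : discretization Omega).
Hypothesis d_gt0 : (0 < d)%N.
Hypothesis dom : domain Omega.
Variables (V : 'rV[R]_d -> 'rV[R]_d) (divV : 'rV[R]_d -> R).
Hypothesis hV : hypothesis_V Omega V divV.
Implicit Types (K L : cell D) (s : face D) (phi : 'rV[R]_d -> R).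
Local Notation leb := (lebesgue_rV R d).

Let mO := domain_measurable dom.
Let fO := domain_finite dom.

(** Formally the divergence of the field phi V, the integrand of Gauss-Green in
    [is_normal_trace]. *)
Definition div_density phi x := dotv (V x) (grad phi x) + divV x * phi x.

Lemma dotv_grad_integrable phi M : C1 phi ->
  (forall x i, `|grad phi x ord0 i| <= M) ->
  leb.-integrable Omega (EFin \o (fun x => dotv (V x) (grad phi x))).
Proof.
move=> Cphi phiM; have [_ Vb _ _ _] := hV.
rewrite (_ : EFin \o _ = (fun x => \sum_i (V x ord0 i * grad phi x ord0 i)%:E)%E); last first.
  by apply/funext => x /=; rewrite dotvE sumEFin.
apply: integrable_sum => // i _.
have [N VN] := Lp_on_bounded (Vb i).
apply: (@integrable_Mbounded _ _ _ _ _ mO _ _ M).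
- exact: (ae_bounded_integrable mO fO (Lp_on_measurable mO (Vb i)) VN).
- apply: measurable_funTS; apply: continuous_measurable_rV.
  rewrite (_ : (fun x => _) = (fun x => 'D_(delta_mx ord0 i) phi x)); first exact: C1_partial.
  by apply/funext => x; rewrite mxE.
- by apply: aeW => x _.
Qed.

Lemma divV_integrable : leb.-integrable Omega (EFin \o divV).
Proof. by have [_ _ dV _ _] := hV; exact: Lp_on2_integrable. Qed.

Lemma divV_mul_integrable phi M : C1 phi -> (forall x, `|phi x| <= M) ->
  leb.-integrable Omega (EFin \o (fun x => divV x * phi x)).
Proof.
move=> Cphi phiM; apply: (@integrable_Mbounded _ _ _ _ _ mO _ _ M).
- exact: divV_integrable.
- by apply: measurable_funTS; apply: continuous_measurable_rV; exact: C1_continuous.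
- by apply: aeW => x _.
Qed.

Lemma div_density_integrable (U : set 'rV[R]_d) phi : C1c_in U phi ->
  leb.-integrable Omega (EFin \o div_density phi).
Proof.
move=> Cphi; have [M phiM] := C1c_in_bounded Cphi; have [C1phi _] := Cphi.
have gi : leb.-integrable Omega (EFin \o (fun x => dotv (V x) (grad phi x))).
  by apply: (@dotv_grad_integrable _ M) => // x i; case: (phiM x) => _.
have di : leb.-integrable Omega (EFin \o (fun x => divV x * phi x)).
  by apply: (@divV_mul_integrable _ M) => // x; case: (phiM x).
exact: (integrableD mO gi di).
Qed.

Lemma div_density_int0 phi : C1c_in Omega phi ->
  \int[leb]_(x in Omega) div_density phi x = 0.
Proof.
move=> Cphi; have [M phiM] := C1c_in_bounded Cphi; have [C1phi _] := Cphi.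
have [_ _ _ wdiv _] := hV.
rewrite /div_density RintegralD//.
- by rewrite wdiv// addNr.
- by apply: (@dotv_grad_integrable _ M) => // x i; case: (phiM x) => _.
- by apply: (@divV_mul_integrable _ M) => // x; case: (phiM x).
Qed.

(** The weak divergence makes the integral over [Omega] vanish. The density is 0 off the union [U],
    and [U] exceeds the two cells only by a piece of a hyperplane. *)
Lemma div_density_split K L s phi : K != L -> s \in faces_of K -> s \in faces_of L ->
  C1c_in (cell_set K `|` face_set s `|` cell_set L) phi ->
  \int[leb]_(x in cell_set K) div_density phi x
  + \int[leb]_(x in cell_set L) div_density phi x = 0.
Proof.
move=> KL sK sL; set U := _ `|` cell_set L => Cphi.
have polyO : polyhedral Omega by case: dom.
have UO : U `<=` Omega := interior_face_nbhd_subset d_gt0 KL sK sL polyO.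
have oU : open U := interior_face_nbhd d_gt0 KL sK sL.
have mU : measurable U by exact: open_measurable_rV.
have CphiO : C1c_in Omega phi.
  case: Cphi => Cp [C [cC CU C0]]; split=> //; exists C; split=> //.
  exact: subset_trans UO.
have fi := div_density_integrable Cphi.
have mK := cell_measurable K; have mL := cell_measurable L.
have mKL : measurable (cell_set K `|` cell_set L) by exact: measurableU.
pose N := U `\` (cell_set K `|` cell_set L).
have mN : measurable N by exact: measurableD.
have UE : U = (cell_set K `|` cell_set L) `|` N.
  apply/seteqP; split=> x.
    move=> Ux; have [KLx|KLx] := pselect ((cell_set K `|` cell_set L) x); first by left.
    by right.
  by move=> [[Kx|Lx]|[]//]; [left; left|right].
have N0 : leb N = 0%E.
  have [n0|n0] := eqVneq (normal K s) 0.
    by have := normal_dotv sK; rewrite n0 dotv0l => /esym/eqP; rewrite oner_eq0.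
  apply/eqP; rewrite eq_le measure_ge0 andbT.
  rewrite -(hyperplane_null (dotv (normal K s) (face_orig s)) n0).
  have NH : N `<=` [set x | dotv (normal K s) x = dotv (normal K s) (face_orig s)].
    move=> x [[[Kx|sx]|Lx] nKL]; [by case: nKL; left| |by case: nKL; right].
    have [xn _] := (face_setP d_gt0 x sK).1 sx; apply/eqP; rewrite /= -subr_eq0.
    by rewrite -dotvBr dotvC xn.
  apply: le_measure => //; rewrite inE//.
  rewrite (_ : mkset _ = dotv (normal K s) @^-1` [set dotv (normal K s) (face_orig s)])//.
  rewrite -[X in measurable X]setTI; apply: measurable_dotv => // i.
  exact: measurable_rV_coord.
have Ui : leb.-integrable U (EFin \o div_density phi) by exact: integrableS fi.
have OE : Omega = U `|` (Omega `\` U) by rewrite setDUK.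
have := div_density_int0 CphiO; rewrite [in X in X -> _]OE Rintegral_setU//; first last.
- by apply/disj_setPS => x [Ux [_]].
- by rewrite -OE.
- exact: measurableD.
rewrite (@Rintegral_eq0 _ _ _ leb (Omega `\` U)) => [|x [_ Ux]]; last first.
  by rewrite /div_density (C1c_in_grad0 Cphi Ux) dotv0r (C1c_in0 Cphi Ux) mulr0 addr0.
rewrite addr0 [in X in X -> _]UE Rintegral_setU//; first last.
- by apply/disj_setPS => x [KLx [_]].
- by rewrite -UE.
rewrite (Rintegral_null_set mN _ N0) ?addr0; last first.
  have /integrableP[/measurable_EFinP mf _] := Ui.
  by apply: measurable_funS mf => // x [].
rewrite Rintegral_setU//.
- by apply: integrableS Ui => // x [Kx|Lx]; [left; left|right].
- by apply/disj_setPS => x [Kx Lx]; exact: (cells_disjoint KL Kx Lx).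
Qed.

(** With the default value every flux is 0, so both conservation and the sign over a cell also hold
    in the second case. *)
Lemma normal_traceP :
  is_normal_trace V divV (normal_trace V divV : cell D -> _) \/
  (normal_trace V divV : cell D -> _) = (fun _ _ _ => 0).
Proof. by rewrite /normal_trace; case: xgetP => [g -> /= gP|_]; [left|right]. Qed.

Lemma flux_trace0 K s :
  (normal_trace V divV : cell D -> _) = (fun _ _ _ => 0) -> flux V divV K s = 0.
Proof. by rewrite /flux => ->; rewrite /face_integral Rintegral_eq0. Qed.

Lemma trace_integrable K s : s \in faces_of K ->
  is_normal_trace V divV (normal_trace V divV : cell D -> _) ->
  (lebesgue_rV R d.-1).-integrable (face_dom s) (EFin \o (fun y =>
    normal_trace V divV K s (chart (face_orig s) (face_frame s) y))).
Proof.
move=> sK /(_ K)[/(_ s sK) bnd _].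
have [M bM] := Lp_on_bounded bnd.
have mf := Lp_on_measurable (face_dom_measurable s) bnd.
have fs := face_dom_finite dom s.
have ms := face_dom_measurable s.
exact: (@ae_bounded_integrable _ _ _ (lebesgue_rV R d.-1) _ ms fs _ M mf bM).
Qed.

(** Every other face of [K] misses the support of [phi]: it lies in the frontier of the open cell
    [K], it is disjoint from [s], and a point of it in the open cell [L] would have points of [K]
    within [L]. *)
Lemma gauss_green_face K L s phi : K != L -> s \in faces_of K -> s \in faces_of L ->
  is_normal_trace V divV (normal_trace V divV : cell D -> _) ->
  C1c_in (cell_set K `|` face_set s `|` cell_set L) phi ->
  \int[leb]_(x in cell_set K) div_density phi x =
  face_integral s (fun x => phi x * normal_trace V divV K s x).
Proof.
move=> KL sK sL tr Cphi; have [_ /(_ phi Cphi.1) ->] := tr K.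
rewrite (bigD1 s)//= big1 ?addr0// => s' /andP[s'K s's].
rewrite /face_integral Rintegral_eq0// => y s'y.
rewrite (C1c_in0 Cphi) ?mul0r// => -[[Kx|sx]|Lx].
- exact: frontier_notin (faces_in_frontier s'K s'y) Kx.
- have /trivIsetP/(_ s' s I I s's) := @face_disjoint _ _ _ D.
  by rewrite -subset0; apply; split; [exact: s'y|exact: sx].
- have [cKx _] := faces_in_frontier s'K s'y.
  have : nbhs (chart (face_orig s') (face_frame s') y) (cell_set L).
    by apply: open_nbhs_nbhs; split=> //; exact: cell_open.
  by move=> /cKx[z [Kz Lz]]; exact: (cells_disjoint KL Kz Lz).
Qed.

Lemma flux_conservation K L s : K != L -> s \in faces_of K -> s \in faces_of L ->
  flux V divV K s + flux V divV L s = 0.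
Proof.
move=> KL sK sL; have [tr|tr0] := normal_traceP; last by rewrite !flux_trace0// addr0.
pose U := cell_set K `|` face_set s `|` cell_set L.
have oU : open U := interior_face_nbhd d_gt0 KL sK sL.
have LK : L != K by rewrite eq_sym.
have UC : U = cell_set L `|` face_set s `|` cell_set K.
  by apply/seteqP; split=> x [[?|?]|?];
    [right|left; right|left; left|right|left; right|left; left].
pose phi k := cutoff U k.
have Cphi k : C1c_in U (phi k) by exact: cutoff_C1c.
pose ch := chart (face_orig s) (face_frame s).
have conv M : s \in faces_of M -> (fun k => face_integral s
    (fun x => phi k x * normal_trace V divV M s x)) @ \oo --> flux V divV M s.
  move=> sM; apply: (@Rintegral_cutoff_cvg _ _ _ _ _ _ (fun k y => phi k (ch y))).
  - exact: face_dom_measurable.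
  - exact: trace_integrable.
  - move=> k; apply: measurable_funTS; apply: continuous_measurable_rV => y.
    have cc : ch @ y --> ch y.
      by apply: contD; [exact: cont_cst|apply: continuous_mulmx; exact: cont_id].
    by apply: (@continuous_comp _ _ _ ch (phi k) y cc); exact: C1_continuous (Cphi k).1 _.
  - by move=> k y _; exact: saturate_bounds.
  - by move=> y sy; apply: cutoff_cvg => //; left; right.
(* Before the limit, the two face integrals are the integrals of one density over [K] and over [L].
   [UC] lets the two cells exchange roles. *)
have sum0 k : face_integral s (fun x => phi k x * normal_trace V divV K s x)
    + face_integral s (fun x => phi k x * normal_trace V divV L s x) = 0.
  rewrite -(gauss_green_face KL sK sL tr (Cphi k)).
  rewrite -(gauss_green_face LK sL sK tr); last by rewrite -UC.
  exact: div_density_split (Cphi k).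
have c0 : (fun _ : nat => 0 : R) @ \oo --> flux V divV K s + flux V divV L s.
  rewrite (_ : (fun _ => 0) = fun k =>
    face_integral s (fun x => phi k x * normal_trace V divV K s x)
    + face_integral s (fun x => phi k x * normal_trace V divV L s x)); last first.
    by apply/funext => k; rewrite sum0.
  by apply: cvgD; exact: conv.
exact: (cvg_unique (@Rhausdorff R) c0 (cvg_cst (0 : R))).
Qed.

(** Gauss-Green with test function 1 identifies the sum with the integral of [divV] over the
    cell. *)
Lemma flux_sum_ge0 K : 0 <= \sum_(s in faces_of K) flux V divV K s.
Proof.
have [tr|tr0] := normal_traceP; last by rewrite big1// => s _; exact: flux_trace0.
have [_ _ dV _ dpos] := hV.
have [_ /(_ (fun=> 1) (C1_cst _ 1))] := tr K.
under [X in _ = X -> _]eq_bigr => s _.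
  have -> : face_integral s (fun x => 1 * normal_trace V divV K s x) = flux V divV K s.
    by apply: eq_Rintegral => y _; rewrite mul1r.
  over.
have g0 : (fun x => dotv (V x) (grad (fun _ : 'rV[R]_d => 1 : R) x) + divV x * 1) = divV.
  apply/funext => x; rewrite (_ : grad _ x = 0) ?dotv0r ?mulr1 ?add0r//.
  by apply/rowP => i; rewrite !mxE; exact: derive_cst.
rewrite g0 => <-; apply: Rintegral_ae_ge0.
- exact: cell_measurable.
- apply: (measurable_funS mO _ (Lp_on_measurable mO dV)); exact: cell_subset.
- by apply: filterS dpos => x dx /cell_subset/dx.
Qed.

(* Upwinding: (a - b) c times the upwind value is at least c (a^2 - b^2) / 2;
   the face terms then cancel by conservation of the fluxes. *)
Lemma form_T_ge0 (u : XD D) : XD0 u -> 0 <= form_T V divV u u.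
Proof.
move=> u0; pose c K s := flux V divV K s.
apply: (@le_trans _ _ (\sum_K \sum_(s in faces_of K)
    (u.1 K ^+ 2 / 2 * c K s - u.2 s ^+ 2 / 2 * c K s))); last first.
  (* For either sign of the flux c, the two sides differ by |c| (a - b)^2 / 2, the numerical
     diffusion of the upwind scheme. *)
  apply: ler_sum => K _; apply: ler_sum => s _.
  rewrite /upwind -/(c K s); have := sqr_ge0 (u.1 K - u.2 s).
  case: ifPn => [c0|]; last rewrite -ltNge => c0; nra.
under eq_bigr do rewrite sumrB -mulr_sumr.
rewrite sumrB subr_ge0; apply: (@le_trans _ _ 0); last first.
  apply: sumr_ge0 => K _; apply: mulr_ge0; last exact: flux_sum_ge0.
  by rewrite divr_ge0// sqr_ge0.
rewrite (exchange_big_dep xpredT)//= big1// => s _; rewrite -mulr_sumr.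
have [[s1 _]|s2] := face_cells s.
  by rewrite u0 ?expr0n ?mul0r// /exterior_face s1.
have /cards2P[K [L [KL KLE]]] : #|cells_of s| == 2%N by rewrite s2.
have memE M : (s \in faces_of M) = (M \in [set K; L]%SET) by rewrite -KLE inE.
under eq_bigl do rewrite memE.
rewrite big_setU1 ?inE//= big_set1 flux_conservation ?mulr0// memE !inE eqxx ?orbT//.
Qed.

End flux.

(** * The diffusion form *)

Section symmetric_matrices.
Context (R : realType) (d : nat).
Implicit Types (A : 'M[R]_d).

Lemma dotv_mulmx_sym A (u v : 'rV[R]_d) : A^T = A ->
  dotv (u *m A) v = dotv (v *m A) u.
Proof.
move=> AT; rewrite dotvC /dotv trmx_mul AT mulmxA.
by congr (_ _ _).
Qed.

(* A minimizer w of the Rayleigh quotient: the form of A - m%:M is nonnegative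
   and vanishes at w, hence w is in its kernel. *)
Lemma min_eigenvalue A : (0 < d)%N -> A^T = A ->
  exists2 m, eigenvalue A m & forall v, m * dotv v v <= dotv (v *m A) v.
Proof.
move=> d0 AT; pose S := [set v : 'rV[R]_d | dotv v v = 1].
have cdot : continuous (fun v : 'rV[R]_d => dotv v v).
  by move=> v; apply: continuous_dotv; exact: cont_id.
have cS : compact S.
  apply: bounded_closed_compact.
    exists 1; split; first exact: num_real.
    move=> M /ltW M1 v Sv; apply: le_trans M1.
    rewrite [leLHS]mx_normrE; apply: bigmax_le => // -[i j] _ /=.
    have -> : i = ord0 by exact: ord1.
    have := sqr_coord_le_dotv v j; rewrite Sv -real_normK ?num_real//.
    by rewrite expr_le1.
  rewrite (_ : S = (fun v : 'rV[R]_d => dotv v v) @^-1` [set 1])//.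
  by apply: preimage_closed => [v _|]; [exact: cdot|exact: closed_eq].
have S0 : S !=set0.
  exists (delta_mx ord0 (Ordinal d0)); rewrite /S /= dotvE (bigD1 (Ordinal d0))//=.
  rewrite !mxE !eqxx mulr1 big1 ?addr0// => i i0.
  by rewrite !mxE (negbTE i0) andbF mulr0.
have [|w Sw wP] := @EVT_min_rV _ _ (fun v => dotv (v *m A) v) S S0 cS.
  apply: continuous_subspaceT => v; apply: continuous_dotv; last exact: cont_id.
  by apply: continuous_mulmx; exact: cont_id.
move: Sw; rewrite inE /S /= => w1.
set m := dotv (w *m A) w in wP *.
have mP v : m * dotv v v <= dotv (v *m A) v.
  have [->|v0] := eqVneq v 0; first by rewrite dotv0r mulr0 mul0mx dotv0l.
  have vv : 0 < dotv v v.
    by rewrite lt0r dotv_ge0 andbT; apply: contra_neq v0; exact: dotv_eq0.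
  pose r := Num.sqrt (dotv v v).
  have r0 : 0 < r by rewrite sqrtr_gt0.
  have rr : dotv v v = r ^+ 2 by rewrite sqr_sqrtr// ltW.
  have : r^-1 *: v \in S.
    by rewrite inE /S /= dotvZl dotvZr rr expr2 mulKf ?gt_eqF// mulVf// gt_eqF.
  move=> /wP; rewrite -scalemxAl dotvZl dotvZr => h.
  have -> : dotv (v *m A) v = r ^+ 2 * (r^-1 * (r^-1 * dotv (v *m A) v)).
    by rewrite expr2 -!mulrA (mulrCA r r^-1) mulKf ?gt_eqF// mulrCA mulKf ?gt_eqF.
  by rewrite rr mulrC ler_pM2l// exprn_gt0.
exists m => //; apply/eigenvalueP; exists w; last first.
  by apply/eqP => w0; move/eqP: w1; rewrite w0 dotv0l eq_sym oner_eq0.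
have [z zE] : exists z, z = w *m A - m *: w by exists (w *m A - m *: w).
suff /eqP : z = 0 by rewrite zE subr_eq0 => /eqP.
pose p v := dotv (v *m A) v - m * dotv v v.
have p0 v : 0 <= p v by rewrite subr_ge0.
have pw t : p (w + t *: z) = 2 * t * dotv z z + t ^+ 2 * p z.
  rewrite /p !(mulmxDl, dotvDl, dotvDr, dotvZl, dotvZr) -!scalemxAl.
  rewrite !(dotvZl, dotvZr) -/m w1 (dotvC z w) (dotv_mulmx_sym z w AT).
  have -> : dotv z z = dotv (w *m A) z - m * dotv w z by rewrite -dotvZl -dotvBl -zE.
  ring.
(* By [pw], [p] along [z] has no constant term and slope 2 |z|^2, so a small negative t makes it
   negative unless z = 0. The chosen t nearly minimizes the quadratic; the [+ 1] keeps the
   denominator positive when [p z = 0]. *)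
have := p0 (w + (- (p z + 1)^-1 * dotv z z) *: z); rewrite pw.
set b := dotv z z; set q := p z => h.
have q0 : 0 <= q by exact: p0.
have b0 : 0 <= b by exact: dotv_ge0.
apply: dotv_eq0; rewrite -/b; apply/eqP; rewrite eq_le b0 andbT leNgt.
apply/negP => bpos; move: h; apply/negP; rewrite -ltNge.
have q1 : 0 < q + 1 by rewrite ltr_wpDl.
have -> : 2 * (- (q + 1)^-1 * b) * b + (- (q + 1)^-1 * b) ^+ 2 * q =
    - (b ^+ 2 / (q + 1) ^+ 2 * (q + 2)).
  by field; rewrite gt_eqF.
by rewrite oppr_lt0 mulr_gt0// ?divr_gt0 ?exprn_gt0// ltr_wpDl.
Qed.

(** The upper bound is the lower one for [- A], whose eigenvalues are the opposites. *)
Lemma eigenvalue_form_bounds A low up : (0 < d)%N -> A^T = A ->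
  (forall a, eigenvalue A a -> low <= a <= up) ->
  forall v, low * dotv v v <= dotv (v *m A) v <= up * dotv v v.
Proof.
move=> d0 AT eA v; have [m mA mv] := min_eigenvalue d0 AT.
have [|m' m'A m'v] := @min_eigenvalue (- A) d0; first by rewrite linearN /= AT.
have /eA /andP[_ m'up] : eigenvalue A (- m').
  have /eigenvalueP[w wA w0] := m'A; apply/eigenvalueP; exists w => //.
  by move: wA; rewrite mulmxN => /eqP; rewrite eqr_oppLR scaleNr => /eqP.
have /andP[lowm _] := eA _ mA.
have vv := dotv_ge0 v.
apply/andP; split.
  by apply: le_trans (mv v); rewrite ler_wpM2r.
have := m'v v; rewrite mulmxN dotvNl => h.
have : - m' * dotv v v <= up * dotv v v by rewrite ler_wpM2r.
lra.
Qed.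

(** Polarization at [e i], [e j] and [e i + e j]; the constant 3 is not sharp. It turns eigenvalue
    bounds on [Lambda] into bounded, hence integrable, entries. *)
Lemma form_bounds_entries A up : A^T = A -> 0 <= up ->
  (forall v, 0 <= dotv (v *m A) v <= up * dotv v v) ->
  forall i j, `|A i j| <= up * 3.
Proof.
move=> AT up0 Aup i j.
pose e k : 'rV[R]_d := delta_mx ord0 k.
have eAE k l : dotv (e k *m A) (e l) = A k l.
  rewrite -rowE dotvE (bigD1 l)//= big1 ?addr0 => [|k' k'l]; rewrite !mxE.
    by rewrite !eqxx mulr1.
  by rewrite (negbTE k'l) andbF mulr0.
have eeE k l : dotv (e k) (e l) = (k == l)%:R.
  rewrite dotvE (bigD1 l)//= big1 ?addr0 => [|k' k'l]; rewrite !mxE.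
    by rewrite !eqxx mulr1 eq_sym.
  by rewrite (negbTE k'l) andbF mulr0.
have := Aup (e i + e j); have := Aup (e i); have := Aup (e j).
rewrite !(mulmxDl, dotvDl, dotvDr) !eAE !eeE !eqxx (eq_sym j i).
have -> : A j i = A i j by rewrite -[in LHS]AT mxE.
have : up * (i == j)%:R <= up by case: eqP => _; rewrite ?mulr1 ?mulr0.
have : 0 <= up * (i == j)%:R by rewrite mulr_ge0.
set x := A i j; rewrite !mulrDr !mulr1; set y := up * _.
move=> y0 y1 /andP[? ?] /andP[? ?] /andP[? ?].
by rewrite ler_norml; apply/andP; split; lra.
Qed.

End symmetric_matrices.

Section discrete_space.
Context (R : realType) (d : nat) (Omega : set 'rV[R]_d) (D : discretization Omega).
Implicit Types (u v w : XD D) (a : R).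

Definition XD_lin a u v : XD D :=
  (fun K => a * u.1 K + v.1 K, fun s => a * u.2 s + v.2 s).

Lemma gradK_lin a u v K : gradK (XD_lin a u v) K = a *: gradK u K + gradK v K.
Proof.
rewrite /gradK scalerA mulrC -scalerA -scalerDr; congr (_ *: _).
rewrite scaler_sumr -big_split; apply: eq_bigr => s _ /=.
by rewrite scalerA -scalerDl; congr (_ *: _); ring.
Qed.

Lemma residual_lin a u v K s :
  residual (XD_lin a u v) K s = a * residual u K s + residual v K s.
Proof.
by rewrite /residual gradK_lin dotvDl dotvZl /=; ring.
Qed.

Lemma gradD_lin a u v x : gradD (XD_lin a u v) x = a *: gradD u x + gradD v x.
Proof.
rewrite /gradD scaler_sumr -big_split; apply: eq_bigr => K _ /=.
rewrite scaler_sumr -big_split; apply: eq_bigr => s _ /=.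
rewrite gradK_lin residual_lin.
move: (gradK u K) (gradK v K) (residual u K s) (residual v K s) => gu gv ru rv.
by apply/rowP => i; rewrite !mxE; ring.
Qed.

Lemma form_T_linl V divV a u v w :
  form_T V divV (XD_lin a u v) w = a * form_T V divV u w + form_T V divV v w.
Proof.
rewrite /form_T mulr_sumr -big_split; apply: eq_bigr => K _ /=.
rewrite mulr_sumr -big_split; apply: eq_bigr => s _ /=; ring.
Qed.

(** The upwind choice depends on the sign of the flux and not on the unknown, so upwinding is
    linear. *)
Lemma form_T_linr V divV a u v w :
  form_T V divV w (XD_lin a u v) = a * form_T V divV w u + form_T V divV w v.
Proof.
rewrite /form_T mulr_sumr -big_split; apply: eq_bigr => K _ /=.
rewrite mulr_sumr -big_split; apply: eq_bigr => s _ /=.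
by rewrite /upwind; case: ifP => _; rewrite /XD_lin /=; ring.
Qed.

Hypothesis d_gt0 : (0 < d)%N.
Hypothesis dom : domain Omega.
Variable Lambda : 'rV[R]_d -> 'M[R]_d.
Hypothesis hL : hypothesis_Lambda Omega Lambda.
Local Notation leb := (lebesgue_rV R d).

Let mO := domain_measurable dom.
Let fO := domain_finite dom.

Lemma gradD_coord_measurable u i : measurable_fun Omega (fun x => gradD u x ord0 i).
Proof.
pose F K s x : R := (s \in faces_of K)%:R * (\1_(cell_cone K s) x *
  (gradK u K + residual u K s *: normal K s) ord0 i).
rewrite (_ : (fun x => _) = fun x => \sum_K \sum_s F K s x); last first.
  apply/funext => x; rewrite /gradD summxE; apply: eq_bigr => K _.
  rewrite summxE big_mkcond; apply: eq_bigr => s _; rewrite /F.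
  by case: ifP => _; rewrite ?mul0r// mul1r [LHS]mxE.
apply: measurable_sum => K; apply: measurable_sum => s; rewrite /F.
have [sK|sK] := boolP (s \in faces_of K); last first.
  rewrite (_ : (fun x => _) = cst 0); first exact: measurable_cst.
  by apply/funext => x; rewrite mul0r.
apply: measurable_funM => //; apply: measurable_funM => //.
by apply: measurable_indic; apply: open_measurable_rV; exact: cell_cone_open.
Qed.

Lemma gradD_coord_bounded u i : exists M, forall x, `|gradD u x ord0 i| <= M.
Proof.
exists (\sum_K \sum_(s in faces_of K)
  `|(gradK u K + residual u K s *: normal K s) ord0 i|) => x.
rewrite /gradD summxE; apply: le_trans (ler_norm_sum _ _ _) _.
apply: ler_sum => K _; rewrite summxE; apply: le_trans (ler_norm_sum _ _ _) _.
apply: ler_sum => s _; rewrite [X in `|X| <= _]mxE normrM -[leRHS]mul1r ler_wpM2r//.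
by rewrite indicE; case: (_ \in _); rewrite ?normr1 ?normr0.
Qed.

Lemma Lambda_form_bounds : exists up, 0 <= up /\
  {ae leb, forall x, Omega x -> forall y : 'rV[R]_d,
    0 <= dotv (y *m Lambda x) y <= up * dotv y y}.
Proof.
have [_ symL [lm [lM [_ _ [low [up [low0 bnd]]] eig]]]] := hL.
exists `|up|; split=> //; apply: filterS2 bnd eig => x bx ex Ox y.
have [b1 [b2 b3]] := bx Ox.
have := @eigenvalue_form_bounds _ _ (Lambda x) (lm x) (lM x) d_gt0 (symL x Ox) (ex Ox) y.
have yy := dotv_ge0 y; move=> /andP[h1 h2]; apply/andP; split.
  by apply: le_trans h1; rewrite mulr_ge0// (le_trans (ltW low0)).
by apply: (le_trans h2); rewrite ler_wpM2r// (le_trans b3)// ler_norm.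
Qed.

Lemma Lambda_integrable i j : leb.-integrable Omega (EFin \o (fun x => Lambda x i j)).
Proof.
have [up [up0 bnd]] := Lambda_form_bounds.
have [mL symL _] := hL.
apply: (@ae_bounded_integrable _ _ _ _ _ mO fO _ (up * 3) (mL i j)).
apply: filterS bnd => x bx Ox.
by apply: form_bounds_entries => //; [exact: symL|exact: bx].
Qed.

Lemma form_F_integrable v u : leb.-integrable Omega
  (EFin \o (fun x => dotv (gradD v x) (gradD u x *m (Lambda x)^T))).
Proof.
rewrite (_ : EFin \o _ = (fun x => \sum_i \sum_j
    (Lambda x i j * (gradD v x ord0 i * gradD u x ord0 j))%:E)%E); last first.
  apply/funext => x /=; rewrite dotvE -sumEFin; apply: eq_bigr => i _.
  rewrite sumEFin; congr _%:E; rewrite mxE mulr_sumr; apply: eq_bigr => j _.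
  by rewrite [(Lambda x)^T _ _]mxE; ring.
apply: integrable_sum => // i _; apply: integrable_sum => // j _.
have [Mv vM] := gradD_coord_bounded v i; have [Mu uM] := gradD_coord_bounded u j.
apply: (@integrable_Mbounded _ _ _ _ _ mO _ _ (Mv * Mu)).
- exact: Lambda_integrable.
- by apply: measurable_funM; exact: gradD_coord_measurable.
- by apply: aeW => x _; rewrite normrM ler_pM.
Qed.

Lemma form_F_linl a u v w :
  form_F Lambda (XD_lin a u v) w = a * form_F Lambda u w + form_F Lambda v w.
Proof.
rewrite /form_F -RintegralZl//; last exact: form_F_integrable.
rewrite -RintegralD//; last exact: form_F_integrable.
  by apply: eq_Rintegral => x _; rewrite gradD_lin dotvDl dotvZl.
exact: (integrableZl mO a (form_F_integrable u w)).
Qed.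

Lemma form_F_linr a u v w :
  form_F Lambda w (XD_lin a u v) = a * form_F Lambda w u + form_F Lambda w v.
Proof.
rewrite /form_F -RintegralZl//; last exact: form_F_integrable.
rewrite -RintegralD//; last exact: form_F_integrable.
  by apply: eq_Rintegral => x _; rewrite gradD_lin mulmxDl -scalemxAl dotvDr dotvZr.
exact: (integrableZl mO a (form_F_integrable w u)).
Qed.

Lemma form_F_ge0 u : 0 <= form_F Lambda u u.
Proof.
have /integrableP[/measurable_EFinP mf _] := form_F_integrable u u.
apply: Rintegral_ae_ge0 => //.
have [up [_ bnd]] := Lambda_form_bounds; have [_ symL _] := hL.
apply: filterS bnd => x bx Ox; rewrite symL// dotvC.
by have /andP[] := bx Ox (gradD u x).
Qed.

End discrete_space.

(** * Existence of a discrete solution *)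

(** The matrix acts on the second argument, the unknown; the first one, the test vector, is left to
    a scalar product, as in [monotone_zero]. *)
Lemma bilinear_form_matrix (R : realType) n (b : 'rV[R]_n -> 'rV[R]_n -> R) :
  (forall a x y z, b (a *: x + y) z = a * b x z + b y z) ->
  (forall a x y z, b z (a *: x + y) = a * b z x + b z y) ->
  exists A : 'M[R]_n, forall x y, b x y = dotv (y *m A) x.
Proof.
move=> bl br; pose e i : 'rV[R]_n := delta_mx ord0 i.
have b0l z : b 0 z = 0.
  have := bl 1 0 0 z; rewrite scaler0 addr0 mul1r => /eqP.
  by rewrite -subr_eq0 opprD addNKr oppr_eq0 => /eqP.
have b0r z : b z 0 = 0.
  have := br 1 0 0 z; rewrite scaler0 addr0 mul1r => /eqP.
  by rewrite -subr_eq0 opprD addNKr oppr_eq0 => /eqP.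
have suml (c : 'I_n -> R) z : b (\sum_i c i *: e i) z = \sum_i c i * b (e i) z.
  by elim/big_rec2: _ => [|i y x _ <-]; rewrite ?b0l ?bl.
have sumr (c : 'I_n -> R) z : b z (\sum_i c i *: e i) = \sum_i c i * b z (e i).
  by elim/big_rec2: _ => [|i y x _ <-]; rewrite ?b0r ?br.
exists (\matrix_(i, j) b (e j) (e i)) => x y.
rewrite [in LHS](row_sum_delta x) suml dotvE; apply: eq_bigr => j _.
rewrite mulrC; congr (_ * _); rewrite mxE [in LHS](row_sum_delta y) sumr.
by apply: eq_bigr => i _; rewrite mxE.
Qed.

Section time_step.
Context (R : realType) (d : nat) (Omega : set 'rV[R]_d) (D : discretization Omega).
Local Notation vec := 'rV[R]_(#|cell D| + #|face D|).

(** Exterior faces keep a coordinate, which is ignored and replaced by 0. The bilinear form is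
    degenerate in these coordinates, and [monotone_zero] asks only for nonnegativity. *)
Definition XD_of (x : vec) : XD D :=
  (fun K => lsubmx x ord0 (enum_rank K),
   fun s => if exterior_face s then 0 else rsubmx x ord0 (enum_rank s)).

Lemma XD_of_lin a (x y : vec) : XD_of (a *: x + y) = XD_lin a (XD_of x) (XD_of y).
Proof.
rewrite /XD_of /XD_lin /=; congr pair; apply/funext => i; first by rewrite !mxE.
by case: ifP => _; rewrite ?mulr0 ?addr0// !mxE.
Qed.

Lemma XD_of_XD0 x : XD0 (XD_of x).
Proof. by move=> s se; rewrite /XD_of /= se. Qed.

Lemma XD0_XD_of (v : XD D) : XD0 v -> exists x, XD_of x = v.
Proof.
move=> v0; exists (row_mx (\row_i v.1 (enum_val i)) (\row_i v.2 (enum_val i))).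
rewrite /XD_of row_mxKl row_mxKr; case: v v0 => v1 v2 v0 /=.
congr pair; apply/funext => i; first by rewrite !mxE enum_rankK.
by case: ifPn => [/v0//|_]; rewrite !mxE enum_rankK.
Qed.

(** Testing with v amounts to taking the scalar product of the vector equation with the coordinates
    of v; the zero block appears because the nonlinear terms involve cell unknowns alone. *)
Lemma time_step_solution (b : XD D -> XD D -> R) (f : cell D -> R -> R) (c : R) :
  0 < c ->
  (forall a u v w, b (XD_lin a u v) w = a * b u w + b v w) ->
  (forall a u v w, b w (XD_lin a u v) = a * b w u + b w v) ->
  (forall u, XD0 u -> 0 <= b u u) ->
  (forall K, continuous (f K)) ->
  (forall K (s t : R), c * (s - t) ^+ 2 <= (f K s - f K t) * (s - t)) ->
  exists u, XD0 u /\
    forall v, XD0 v -> \sum_K v.1 K * f K (u.1 K) + b v u = 0.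
Proof.
move=> c0 bl br bpos cf mf.
have [||A bA] := @bilinear_form_matrix R _ (fun x y => b (XD_of x) (XD_of y)).
- by move=> a x y z; rewrite XD_of_lin bl.
- by move=> a x y z; rewrite XD_of_lin br.
have [|i|i s t|x xP] := @monotone_zero R _ _ A (fun i => f (enum_val i)) c c0.
- by move=> x; rewrite -bA; apply: bpos; exact: XD_of_XD0.
- exact: cf.
- exact: mf.
exists (XD_of x); split; first exact: XD_of_XD0.
move=> v /XD0_XD_of[y <-]; rewrite bA.
move/(congr1 (fun z => dotv z y)): xP; rewrite dotvDl dotv0l => xy; rewrite -[RHS]xy.
congr (_ + _); rewrite -[y in RHS]hsubmxK dotv_row_mx dotv0l addr0 [RHS]dotvE.
rewrite [RHS](reindex (@enum_rank (cell D)))/=; last exact/onW_bij/enum_rank_bij.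
by apply: eq_bigr => K _; rewrite mxE enum_rankK mulrC.
Qed.

End time_step.

(** The hypothesis bounds absolute values; the monotonicity of [beta] supplies the signs that remove
    them. *)
Lemma beta_strongly_monotone (R : realType) (beta : R -> R) (beta_low : R) :
  hypothesis_beta beta beta_low ->
  forall s t, beta_low * (s - t) ^+ 2 <= (beta s - beta t) * (s - t).
Proof.
move=> [_ _ bmono [low0 blow] _] s t; have := blow s t.
have [st|st|->] := ltgtP s t; last by rewrite !subrr expr0n /= !mulr0.
- have := bmono _ _ st => bst; rewrite !ltr0_norm ?subr_lt0// => h.
  rewrite expr2 mulrA -subr_ge0 -mulrBl mulr_le0// ?subr_le0 ?(ltW st)//; lra.
- have := bmono _ _ st => bst; rewrite !gtr0_norm ?subr_gt0// => h.
  by rewrite expr2 mulrA ler_wpM2r// subr_ge0 ltW.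
Qed.

(** The inverse of 1 plus the sum of the inverses is below every [m i]; the 1 keeps it meaningful
    for an empty [I]. *)
Lemma positive_lower_bound (R : realType) (I : finType) (m : I -> R) :
  (forall i, 0 < m i) -> exists2 c, 0 < c & forall i, c <= m i.
Proof.
move=> m0; have S0 : 0 < 1 + \sum_i (m i)^-1.
  by rewrite ltr_pwDl// sumr_ge0// => i _; rewrite invr_ge0 ltW.
exists (1 + \sum_i (m i)^-1)^-1; first by rewrite invr_gt0.
move=> i; rewrite -[leRHS]invrK lef_pV2 ?posrE ?invr_gt0//.
rewrite (bigD1 i)//= addrCA lerDl addr_ge0// sumr_ge0// => j _.
by rewrite invr_ge0 ltW.
Qed.

Theorem theorem3p1 (R : realType) (d : nat) (Omega : set 'rV[R]_d) (T : R)
    (beta : R -> R) (beta_low : R) (Lambda : 'rV[R]_d -> 'M[R]_d)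
    (V : 'rV[R]_d -> 'rV[R]_d) (divV : 'rV[R]_d -> R) (u0 : 'rV[R]_d -> R)
    (F : R -> R) (F_low : R) (q : 'rV[R]_d * measurableTypeR R -> R)
    (D : discretization Omega) (N : nat) :
  (0 < d)%N -> 0 < T -> domain Omega ->
  hypothesis_beta beta beta_low ->
  hypothesis_Lambda Omega Lambda ->
  hypothesis_V Omega V divV ->
  hypothesis_u0 Omega u0 ->
  hypothesis_F F F_low ->
  hypothesis_q Omega T q ->
  (0 < N)%N ->
  T / N%:R < beta_low / F_low ->
  exists u : nat -> XD D,
    discrete_solution beta F Lambda V divV u0 q (T / N%:R) N u.
Proof.
move=> d0 T0 dom hb hL hV _ hF _ N0; set dt := T / N%:R => dtlt.
have dt0 : 0 < dt by rewrite divr_gt0// ltr0n.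
have [cF _ _ Flow0 Fmono] := hF.
have [cb _ _ _ _] := hb.
have bmono := beta_strongly_monotone hb.
have [m m0 mP] := positive_lower_bound (@cell_vol_gt0 _ _ _ D).
(* The monotonicity constant of [beta / dt + F], positive by the restriction on the time step.
   Multiplying by the least volume bound [m] makes it uniform over the cells. *)
pose k := beta_low / dt - F_low.
have k0 : 0 < k.
  by rewrite subr_gt0 ltr_pdivlMr// mulrC -ltr_pdivlMr.
have step (n : nat) (prev : cell D -> R) : exists u : XD D, XD0 u /\
    forall v, XD0 v ->
      \sum_K vol (cell_set K) * v.1 K * ((beta (u.1 K) - beta (prev K)) / dt)
      + form_F Lambda v u + form_T V divV v u
      + \sum_K vol (cell_set K) * v.1 K * F (u.1 K)
      = \sum_K vol (cell_set K) * v.1 K * source q dt n K.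
  (* The previous value and the source do not depend on [s]: they cancel in the monotonicity
     inequality, and the right-hand side of the scheme is absorbed in [f]. *)
  pose f (K : cell D) s := vol (cell_set K) *
    ((beta s - beta (prev K)) / dt + F s - source q dt n K).
  have addE (x y z t p : R) : x * y + z + (x * t + p) = x * (y + t) + (z + p).
    by ring.
  have [||||K|K s t|u [uD uP]] := @time_step_solution R d Omega D
    (fun v u => form_F Lambda v u + form_T V divV v u) f (m * k).
  - by rewrite mulr_gt0.
  - move=> a u v w; rewrite (form_F_linl d0 dom hL) form_T_linl; exact: addE.
  - move=> a u v w; rewrite (form_F_linr d0 dom hL) form_T_linr; exact: addE.
  - move=> u uD; apply: addr_ge0; first exact: (form_F_ge0 d0 dom hL).
    exact: (form_T_ge0 d0 dom hV uD).
  - move=> s; apply: contM; first exact: cont_cst.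
    apply: contB; last exact: cont_cst.
    apply: contD; last exact: cF.
    apply: contM; last exact: cont_cst.
    by apply: contB; [exact: cb|exact: cont_cst].
  - have E (a b1 b2 b3 r f1 f2 e x : R) :
        (a * ((b1 - b3) / r + f1 - e) - a * ((b2 - b3) / r + f2 - e)) * x =
        a * ((b1 - b2) * x / r + (f1 - f2) * x) by ring.
    rewrite /f E -[leLHS]mulrA; apply: ler_pM; [exact: ltW| |exact: mP|].
      by apply: mulr_ge0; [exact: ltW|exact: sqr_ge0].
    have : beta_low * (s - t) ^+ 2 / dt <= (beta s - beta t) * (s - t) / dt.
      by rewrite ler_pM2r ?invr_gt0.
    by have := Fmono s t; rewrite /k; lra.
  exists u; split=> // v vD; apply/eqP; rewrite -subr_eq0; apply/eqP.
  rewrite -[RHS](uP v vD).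
  have -> : \sum_K v.1 K * f K (u.1 K) =
      \sum_K vol (cell_set K) * v.1 K * ((beta (u.1 K) - beta (prev K)) / dt)
      + \sum_K vol (cell_set K) * v.1 K * F (u.1 K)
      - \sum_K vol (cell_set K) * v.1 K * source q dt n K.
    have E (a x b e g : R) : x * (a * (b + e - g)) = a * x * b + a * x * e - a * x * g.
      by ring.
    by rewrite -big_split -sumrB; apply: eq_bigr => K _; exact: E.
  have E (a b e f1 t : R) : a + f1 + t + b - e = a + b - e + (f1 + t) by ring.
  exact: E.
have /choice[next nextP] : forall np : nat * (cell D -> R), exists u : XD D, XD0 u /\
    forall v, XD0 v ->
      \sum_K vol (cell_set K) * v.1 K * ((beta (u.1 K) - beta (np.2 K)) / dt)
      + form_F Lambda v u + form_T V divV v u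
      + \sum_K vol (cell_set K) * v.1 K * F (u.1 K)
      = \sum_K vol (cell_set K) * v.1 K * source q dt np.1 K.
  by move=> [n prev]; exact: step.
(* Index 0 only hosts the cell means of [u0], with an arbitrary face part; each later step reads
   nothing but the cell part of its predecessor. *)
pose u := fix u n : XD D :=
  if n is n'.+1 then next (n, (u n').1) else (cell_mean u0, fun=> 0).
exists u => n /andP[n0 nN]; case: n n0 nN => // n _ nN.
have [uD uP] := nextP (n.+1, (u n).1); split=> // v vD.
by case: n nN uD uP => [|n] _ _ uP; exact: uP.
Qed.
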